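(* Let $T>0$ and $x\in\mathbb{R}$. Consider, for each $\varepsilon>0$, the Brownian skeleton $(BS)_\eta$ (defined in the context) with $\eta\equiv1$ and $x_0^\varepsilon=x$, and let $N_T^\varepsilon=\inf\{n\ge1:\ s_n^\varepsilon\ge T\}$ be the number of approximation points needed to cover $[0,T]$. Then $$\lim_{\varepsilon\to0}\varepsilon^2\,\mathbb{E}[N_T^\varepsilon]=\frac{T}{e}\,3^{3/2}.$$ Moreover the following central limit theorem holds: $$\lim_{\varepsilon\to0}\sqrt{\frac{\mu^3}{\varepsilon^2\sigma^2T}}\left(\varepsilon^2N_T^\varepsilon-\frac{T}{e}\,3^{3/2}\right)=G\quad\text{in distribution},$$ where $G$ is a standard Gaussian $\mathcal{N}(0,1)$ random variable, $\mu=e\,3^{-3/2}$ and $\sigma^2=(5^{-3/2}-3^{-3})\,e^2$.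
   Context: Brownian skeleton $(BS)_\eta$. For $\varepsilon>0$ let $\phi_\varepsilon(t)=\sqrt{t\ln(\varepsilon^2e/t)}$ for $t\in[0,r_\varepsilon]$, $r_\varepsilon=e\varepsilon^2$ (with $\phi_\varepsilon(0)=0$). Let $(A_n)_{n\ge1}$ be i.i.d. random variables with gamma distribution $\Gamma(3/2,2)$ (shape $3/2$, scale $2$, i.e. Laplace transform $s\mapsto(1+2s)^{-3/2}$), and $(Z_n)_{n\ge1}$ i.i.d. Rademacher variables (values $\pm1$ with probability $1/2$), independent of $(A_n)$. For a function $\eta:\mathbb{R}\to\mathbb{R}_+$ and $x\in\mathbb{R}$, the skeleton is the family $((U_n^\varepsilon)_{n\ge1},(s_n^\varepsilon)_{n\ge1},(x_n^\varepsilon)_{n\ge0})$ defined by $x_0^\varepsilon=x$, $s_0^\varepsilon=0$ and, for $n\ge1$, $$U_n^\varepsilon=\varepsilon^2\eta^2(x_{n-1}^\varepsilon)e^{1-A_n},\quad s_n^\varepsilon=\sum_{k=1}^nU_k^\varepsilon,\quad x_n^\varepsilon=x_{n-1}^\varepsilon+Z_n\,\eta(x_{n-1}^\varepsilon)\,\phi_\varepsilon\!\left(\frac{U_n^\varepsilon}{\eta^2(x_{n-1}^\varepsilon)}\right).$$ *)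

(* Defs.v *)
From HB Require Import structures.
From mathcomp Require Import all_boot all_order all_algebra.
From mathcomp Require Import all_classical all_reals all_analysis.

Set Implicit Arguments.
Unset Strict Implicit.
Unset Printing Implicit Defensive.

Import Order.TTheory GRing.Theory Num.Theory.
Import numFieldNormedType.Exports.

Local Open Scope classical_set_scope.
Local Open Scope ring_scope.

Definition gamma_fun {R : realType} (k : R) : R :=
  \int[lebesgue_measure]_(t in `[0, +oo[) (t `^ (k - 1) * expR (- t)).

(* Shape k and scale theta. *)
Definition gamma_pdf {R : realType} (k theta x : R) : R :=
  if 0 < x then x `^ (k - 1) * expR (- (x / theta)) / (gamma_fun k * theta `^ k)
  else 0.

Definition gamma_prob {R : realType} (k theta : R) (V : set R) : \bar R :=
  (\int[lebesgue_measure]_(x in V) (gamma_pdf k theta x)%:E)%E.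

Section probability.
Context d (Omega : measurableType d) (R : realType) (P : probability Omega R).

Definition mutually_independent (X : nat -> {RV P >-> R}) : Prop :=
  forall (s : seq nat) (B : nat -> set R), uniq s ->
    (forall i, measurable (B i)) ->
    P (\bigcap_(i in [set` s]) X i @^-1` B i) =
    (\prod_(i <- s) P (X i @^-1` B i))%E.

Definition sigma_of (X : nat -> {RV P >-> R}) : set (set Omega) :=
  <<s \bigcup_n preimage_set_system setT (X n) measurable >>.

Definition independent_seqs (X Y : nat -> {RV P >-> R}) : Prop :=
  forall E F, sigma_of X E -> sigma_of Y F -> P (E `&` F) = (P E * P F)%E.

Definition iid_gamma (k theta : R) (X : nat -> {RV P >-> R}) : Prop :=
  mutually_independent X /\
  forall n (B : set R), measurable B ->
    distribution P (X n) B = gamma_prob k theta B.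

Definition iid_rademacher (X : nat -> {RV P >-> R}) : Prop :=
  mutually_independent X /\
  forall n, P [set w | X n w = 1] = (1 / 2)%:E /\
            P [set w | X n w = -1] = (1 / 2)%:E.

(* Convergence in distribution, along the filter F on the parameter, of the
   extended-real-valued variables X e to the probability mu on R: the
   distribution functions converge at the continuity points of that of mu.
   As mu has mass 1 on R, this forces P (X e = +oo) and P (X e = -oo) to vanish
   in the limit. *)
Definition cvg_in_distribution {I : Type} (F : set_system I)
    (X : I -> Omega -> \bar R) (mu : probability (measurableTypeR R) R) : Prop :=
  forall t : R, {for t, continuous (fun u : R => mu `]-oo, u]%classic)} ->
    P [set w | (X e w <= t%:E)%E] @[e --> F] --> mu `]-oo, t]%classic.

End probability.

(* The skeleton, for fixed values of the driving sequences.  The sequences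
   (A_n), (Z_n), (U_n), which start at n = 1, are indexed from 0 here: a k,
   z k and bs_U k stand for A_(k+1), Z_(k+1) and U_(k+1); bs_s and bs_x keep
   their indices. *)
Section skeleton.
Context {R : realType}.
Variables (eta : R -> R) (x eps : R) (a z : nat -> R).

(* Since t * ln (.. / t) and Num.sqrt vanish at 0, this is 0 at t = 0. *)
Definition bs_phi (t : R) : R := Num.sqrt (t * ln (eps ^+ 2 * expR 1 / t)).

Definition bs_duration (y u : R) : R := eps ^+ 2 * eta y ^+ 2 * expR (1 - u).

Fixpoint bs_x (n : nat) : R :=
  match n with
  | 0%N => x
  | m.+1 => bs_x m +
      z m * eta (bs_x m) *
        bs_phi (bs_duration (bs_x m) (a m) / eta (bs_x m) ^+ 2)
  end.

Definition bs_U (n : nat) : R := bs_duration (bs_x n) (a n).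

Definition bs_s (n : nat) : R := \sum_(k < n) bs_U k.

(* Infimum in the extended reals: +oo when s_n stays below T. *)
Definition bs_N (T : R) : \bar R :=
  ereal_inf [set n%:R%:E | n in [set n : nat | (1 <= n)%N /\ T <= bs_s n]].

End skeleton.

(* Main.v *)
Require Import Defs.
From HB Require Import structures.
From mathcomp Require Import all_boot all_order all_algebra.
From mathcomp Require Import all_classical all_reals all_analysis.
From mathcomp Require Import measurable_realfun ring lra.

(* Put V_n = expR (1 - A_n) and t = T / eps^2.  As eta = 1, U_n = eps^2 * V_n, so
   N is the first n with S_n >= t, where S_n is the sum of the first n terms V,
   and the Laplace transform of the Gamma law at j = 1, 2, 3 gives the moments
   E V^j = e^j (1 + 2j)^(-3/2) of these i.i.d. variables, so mu and sigma2 are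
   their mean and variance.

   Expectation: {N > k} = {S_k < t} is independent of V_k, whence Wald's
   identity mu * E N = E S_N, and t <= S_N <= t + e as V <= e almost surely.
   Both bounds are obtained from truncated sums over k < K, which avoids
   manipulating S_N itself.

   Fluctuations: {N <= r} = {S_n >= t} for n the integer part of r, so the law
   of N follows from the central limit theorem for the S_n, uniformly in the
   threshold because t varies with n.  That theorem is proved by Lindeberg's
   replacement method: convolution operators f |-> E f(y + X) commute and
   contract the sup norm, so replacing n of them by Gaussian ones costs n times
   the third order Taylor error of the test function, here a rescaled logistic
   function, which decreases smoothly from 1 to 0. *)

Set Implicit Arguments.
Unset Strict Implicit.
Unset Printing Implicit Defensive.

Import Order.TTheory GRing.Theory Num.Theory.
Import numFieldNormedType.Exports.

Local Open Scope classical_set_scope.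
Local Open Scope ring_scope.

(** * Densities *)

(** Of the Gaussian laws the replacement method uses only stability under convolution, scaling, a
    Lipschitz distribution function, mean 0, variance 1 and a finite third absolute moment; no
    Fourier analysis enters. In units where n summands have standard deviation sqrt n, a step of
    steepness k / sqrt n has a Taylor remainder of order (k / sqrt n)^3, so n replacements cost
    about k^3 / sqrt n. The steepness k is fixed before n, by the precision wanted when passing from
    steps back to indicators.

    The index N may be infinite on some paths, so everything about it is read from the monotone
    events {S_k < t}. The convergence of the series of their probabilities is not presupposed: it
    follows from bounds on the partial sums that are uniform in K.

    The index r with eps^2 * r = T / mu + u * eps * q is not an integer. Rounding moves it by less
    than 1 and the standardized threshold by O(eps), which the Lipschitz bound absorbs. Here q =
    sigma * sqrt (T / mu) / mu, and 1 / (eps * q) is exactly the normalization sqrt (mu^3 / (eps^2 *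
    sigma^2 * T)) of the theorem. *)

Section affine_change_of_variables.
Context {R : realType}.
Local Notation mu := (@lebesgue_measure R).

Let affine (c b x : R) : measurableTypeR R := c * x + b.

Let measurable_affine c b : measurable_fun setT (affine c b).
Proof. by apply: measurable_funD => //; exact: measurable_funM. Qed.

(** By uniqueness of Lebesgue measure it suffices to test the intervals []u, v]], whose preimage is
    again a half-open interval, open on the other side when [c < 0]. *)
Let lebesgue_measure_affine c b (A : set R) : c != 0 -> measurable A ->
  mu A = (`|c|%:E * pushforward mu (affine c b) A)%E.
Proof.
move=> c0 mA.
pose push : {measure set (measurableTypeR R) -> \bar R} :=
  measure_function_pushforward__canonical__measure_function_Measure
    mu (measurable_affine c b).
pose m : {measure set (measurableTypeR R) -> \bar R} :=
  mscale (NngNum (normr_ge0 c)) push.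
rewrite (@lebesgue_measure_unique _ m)// => _ [[u v]] /= uv <-.
have [c_gt0|c_lt0] : 0 < c \/ c < 0 by apply/orP; rewrite -neq_lt eq_sym.
- rewrite /m /= /mscale /=.
  rewrite -[pushforward _ _ _]/(mu (affine c b @^-1` `]u, v])).
  have -> : affine c b @^-1` `]u, v] = `](u - b) / c, (v - b) / c]%classic.
    apply/seteqP; split => x /=; rewrite !in_itv /= /affine.
      by rewrite ltr_pdivrMr// ler_pdivlMr// (mulrC x) ltrBlDr lerBrDr.
    by rewrite ltr_pdivrMr// ler_pdivlMr// (mulrC x) ltrBlDr lerBrDr.
  rewrite !lebesgue_measure_itv/= !lte_fin ltr_pM2r ?invr_gt0// ltrD2r.
  case: ifP => _; last by rewrite mule0.
  by rewrite -!EFinB -EFinM (gtr0_norm c_gt0); congr EFin; field.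
- rewrite /m /= /mscale /=.
  rewrite -[pushforward _ _ _]/(mu (affine c b @^-1` `]u, v])).
  have -> : affine c b @^-1` `]u, v] = `[(v - b) / c, (u - b) / c[%classic.
    apply/seteqP; split => x /=; rewrite !in_itv /= /affine.
      by rewrite ltr_ndivlMr// ler_ndivrMr// (mulrC x) ltrBlDr lerBrDr andbC.
    by rewrite ltr_ndivlMr// ler_ndivrMr// (mulrC x) ltrBlDr lerBrDr andbC.
  rewrite !lebesgue_measure_itv/= !lte_fin ltr_nM2r ?invr_lt0// ltrD2r.
  case: ifP => _; last by rewrite mule0.
  by rewrite -!EFinB -EFinM (ltr0_norm c_lt0); congr EFin; field.
Qed.

Lemma ge0_integral_affine (c b : R) (f : R -> \bar R) : c != 0 ->
  measurable_fun setT f -> (forall x, (0 <= f x)%E) ->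
  (\int[mu]_x f (c * x + b)%R = (`|c|^-1)%:E * \int[mu]_x f x)%E.
Proof.
move=> c0 mf f0.
have nc0 : 0 <= `|c|^-1 by rewrite invr_ge0.
have -> : (\int[mu]_x f (c * x + b)%R = \int[pushforward mu (affine c b)]_x f x)%E.
  by rewrite ge0_integral_pushforward//; exact: measurable_affine.
have <- : (\int[mscale (NngNum nc0) mu]_x f x =
    (`|c|^-1)%:E * \int[mu]_x f x)%E.
  by rewrite ge0_integral_mscale.
apply: (eq_measure_integral (mscale (NngNum nc0) mu)).
  exact: measurable_affine.
move=> ? A mA _; rewrite /= /mscale /= (lebesgue_measure_affine b c0 mA) muleA.
by rewrite -EFinM mulVf ?normr_eq0// mul1e.
Qed.

End affine_change_of_variables.

Section density.
Context {R : realType}.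
Local Notation mu := (@lebesgue_measure R).
Variables (m : probability (measurableTypeR R) R) (p : R -> R).
Hypothesis mp : measurable_fun setT p.
Hypothesis p0 : forall x, 0 <= p x.
Hypothesis mE : forall A, measurable A -> m A = (\int[mu]_(x in A) (p x)%:E)%E.

(** Having the same integrals over all measurable sets, [p] and the Radon-Nikodym derivative of [m]
    agree almost everywhere, and the change of measure formula holds for the latter. *)
Lemma ge0_integral_density (f : R -> \bar R) : measurable_fun setT f ->
  (forall x, (0 <= f x)%E) -> (\int[m]_x f x = \int[mu]_x (f x * (p x)%:E))%E.
Proof.
move=> mf f0.
have dom : m `<< mu.
  apply/null_content_dominatesP => A mA A0.
  by rewrite mE//; apply: null_set_integral => //; exact/measurable_funTS/measurable_EFinP.
rewrite -(Radon_Nikodym_SigmaFinite.change_of_variables dom)//.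
apply: ae_eq_integral => //.
- apply: emeasurable_funM => //.
  exact: measurable_int (Radon_Nikodym_SigmaFinite.f_integrable dom).
- by apply: emeasurable_funM => //; exact/measurable_EFinP.
- apply: ae_eqe_mul2l.
  apply: integral_ae_eq => //.
  + exact: Radon_Nikodym_SigmaFinite.f_integrable.
  + exact/measurable_EFinP.
  + move=> E _ mE'; rewrite -mE//.
    by rewrite -(Radon_Nikodym_SigmaFinite.f_integral dom).
Qed.

End density.

Lemma integral_probability1 d (T : measurableType d) (R : realType)
  (m : probability T R) : (\int[m]_x 1 = 1 :> \bar R)%E.
Proof. by rewrite integral_cst//= mul1e probability_setT. Qed.

Lemma integrable_pow_le3 {R : realType} (m : probability (measurableTypeR R) R)
    (k : nat) : (\int[m]_x (`|x| ^+ 3)%:E < +oo)%E -> (k <= 3)%N ->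
  m.-integrable setT (fun x => (x ^+ k)%:E).
Proof.
move=> m3 k3.
have m1 : measurable_fun setT (fun x : R => (`|x| ^+ 3)%:E).
  by apply/measurable_EFinP/measurable_funX; exact: normr_measurable.
apply: (@le_integrable _ _ _ m _ measurableT _ (fun x : R => (1 + `|x| ^+ 3)%:E)).
- by apply/measurable_EFinP; exact: measurable_funX.
- move=> x _; rewrite /= lee_fin normrX [leRHS]ger0_norm ?addr_ge0 ?exprn_ge0//.
  have [x1|x1] := leP `|x| 1.
    by rewrite (le_trans (exprn_ile1 _ _ _))// lerDl exprn_ge0.
  by rewrite (le_trans (ler_weXn2l (ltW x1) k3))// lerDr.
- apply/integrableP; split.
    apply/measurable_EFinP/measurable_funD => //.
    exact/measurable_EFinP.
  under eq_integral do rewrite /= ger0_norm ?addr_ge0 ?exprn_ge0// EFinD.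
  rewrite ge0_integralD// lte_add_pinfty//.
  by rewrite integral_probability1 ltry.
Qed.

(** * Normal distribution *)

Section normal_distribution.
Context {R : realType}.
Local Notation mu := (@lebesgue_measure R).
Implicit Types (s x y : R).

Lemma ge0_integral_normal_prob (m s : R) (f : R -> \bar R) :
  measurable_fun setT f -> (forall x, (0 <= f x)%E) ->
  (\int[normal_prob m s]_x f x = \int[mu]_x (f x * (normal_pdf m s x)%:E))%E.
Proof.
move=> mf f0; apply: ge0_integral_density => //.
exact: measurable_normal_pdf.
Qed.

Lemma normal_prob_opp s (f : R -> \bar R) : s != 0 ->
  measurable_fun setT f -> (forall x, (0 <= f x)%E) ->
  (\int[normal_prob 0 s]_x f (- x)%R = \int[normal_prob 0 s]_x f x)%E.
Proof.
move=> s0 mf f0; rewrite !ge0_integral_normal_prob//; last first.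
  exact: measurableT_comp.
have := @ge0_integral_affine R (-1) 0 (fun x => f x * (normal_pdf 0 s x)%:E)%E.
have -> : `|-1 : R|^-1 = 1 by rewrite normrN1 invr1.
rewrite mul1e => /(_ _ _ _) <-.
- apply: eq_integral => x _; rewrite addr0 mulN1r; congr (_ * _%:E)%E.
  by rewrite !normal_pdfE//= /normal_fun !subr0 sqrrN.
- by rewrite oppr_eq0 oner_eq0.
- apply: emeasurable_funM => //; apply/measurable_EFinP.
  exact: measurable_normal_pdf.
- by move=> x; rewrite mule_ge0// lee_fin normal_pdf_ge0.
Qed.

Lemma normal_peakE s : 0 < s -> normal_peak s = s^-1 * normal_peak 1.
Proof.
move=> s0; rewrite /normal_peak expr1n mul1r -mulrnAr sqrtrM ?sqr_ge0//.
by rewrite sqrtr_sqr gtr0_norm// invfM.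
Qed.

(** Completion of the square in [x]: the joint density of a first normal variable [x] and the sum
    [z] is the density of the sum times the conditional density of [x] given the sum. *)
Lemma normal_pdfM (s1 s2 x z : R) : 0 < s1 -> 0 < s2 ->
  let s := Num.sqrt (s1 ^+ 2 + s2 ^+ 2) in
  normal_pdf 0 s1 x * normal_pdf 0 s2 (z - x) =
  normal_pdf 0 s z * normal_pdf (s1 ^+ 2 / s ^+ 2 * z) (s1 * s2 / s) x.
Proof.
move=> s10 s20 s.
have s0 : 0 < s by rewrite sqrtr_gt0 addr_gt0 ?exprn_gt0.
have ss : s ^+ 2 = s1 ^+ 2 + s2 ^+ 2.
  by rewrite sqr_sqrtr// addr_ge0// ?sqr_ge0.
have t0 : 0 < s1 * s2 / s by rewrite divr_gt0 ?mulr_gt0.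
rewrite !normal_pdfE ?gt_eqF//= (normal_peakE s10) (normal_peakE s20).
rewrite (normal_peakE s0) (normal_peakE t0).
rewrite mulrACA [RHS]mulrACA -!expRD.
have ss0 : s1 ^+ 2 + s2 ^+ 2 != 0 by rewrite -ss gt_eqF// exprn_gt0.
congr (_ * expR _).
  by field; rewrite !gt_eqF.
rewrite !exprMn !exprVn !ss; field.
by rewrite ss0 !gt_eqF.
Qed.

(** After the change of variable to the sum and an exchange of integrals, the conditional density
    isolated by [normal_pdfM] integrates to 1. *)
Lemma normal_prob_convolution (s1 s2 : R) (f : R -> \bar R) :
  0 < s1 -> 0 < s2 -> measurable_fun setT f -> (forall x, (0 <= f x)%E) ->
  (\int[normal_prob 0 s1]_x \int[normal_prob 0 s2]_z f (x + z)%R =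
   \int[normal_prob 0 (Num.sqrt (s1 ^+ 2 + s2 ^+ 2))]_x f x)%E.
Proof.
move=> s10 s20 mf f0; set s := Num.sqrt _.
have mp m t : measurable_fun setT (EFin \o normal_pdf m t : R -> \bar R).
  by apply/measurable_EFinP; exact: measurable_normal_pdf.
have p0 m t x : (0 <= (normal_pdf m t x)%:E :> \bar R)%E.
  by rewrite lee_fin normal_pdf_ge0.
pose g (xz : R * R) : \bar R :=
  (f xz.2 * (normal_pdf 0 s2 (xz.2 - xz.1))%:E * (normal_pdf 0 s1 xz.1)%:E)%E.
have mg : measurable_fun setT g.
  apply: emeasurable_funM; last exact: (measurableT_comp (mp 0 s1)).
  apply: emeasurable_funM; first exact: measurableT_comp.
  apply: (measurableT_comp (mp 0 s2)) => //.
  exact: measurable_funB.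
have g0 xz : (0 <= g xz)%E by rewrite !mule_ge0.
transitivity (\int[mu]_x \int[mu]_z g (x, z))%E.
  rewrite ge0_integral_normal_prob; last 2 first.
  - apply: (@measurable_fun_fubini_tonelli_F _ _ _ _ _ (normal_prob 0 s2)
      (fun xz : R * R => f (xz.1 + xz.2)%R)) => //.
    by apply: measurableT_comp => //; exact: measurable_funD.
  - by move=> x; exact: integral_ge0.
  apply: eq_integral => x _.
  rewrite ge0_integral_normal_prob//; last first.
    by apply: measurableT_comp => //; exact: measurable_funD.
  have mh : measurable_fun setT
      (fun z => f z * (normal_pdf 0 s2 (z - x))%:E)%E.
    apply: emeasurable_funM => //; apply: (measurableT_comp (mp 0 s2)) => //.
    exact: measurable_funB.
  have h0 z : (0 <= f z * (normal_pdf 0 s2 (z - x))%:E)%E by exact: mule_ge0.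
  have -> : (\int[mu]_z g (x, z) = (\int[mu]_z (f z * (normal_pdf 0 s2 (z - x))%:E)) *
      (normal_pdf 0 s1 x)%:E)%E.
    exact: (ge0_integralZr mu measurableT mh (fun z _ => h0 z) (p0 0 s1 x)).
  have -> // : (\int[mu]_z (f (x + z)%R * (normal_pdf 0 s2 z)%:E) =
      \int[mu]_z (f z * (normal_pdf 0 s2 (z - x))%:E))%E.
  have := ge0_integral_affine x (oner_neq0 R) mh h0.
  have -> : `|1 : R|^-1 = 1 by rewrite normr1 invr1.
  rewrite mul1e => <-.
  by apply: eq_integral => z _; rewrite mul1r addrK addrC.
rewrite (fubini_tonelli (m1 := mu) (m2 := mu) g)//.
rewrite ge0_integral_normal_prob//; apply: eq_integral => z _.
have -> : (\int[mu]_x g (x, z) = \int[mu]_x ((f z * (normal_pdf 0 s z)%:E) *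
    (normal_pdf (s1 ^+ 2 / s ^+ 2 * z) (s1 * s2 / s) x)%:E))%E.
  apply: eq_integral => x _; rewrite /g/=.
  rewrite -muleA -EFinM [(normal_pdf 0 s2 _ * _)%R]mulrC.
  by rewrite (normal_pdfM _ _ s10 s20) EFinM muleA.
rewrite ge0_integralZl ?integral_normal_pdf ?mule1//; first exact: (mp _ _).
exact: mule_ge0.
Qed.

Lemma normal_probE (m s : R) (A : set R) : measurable A ->
  (normal_prob m s A = \int[mu]_x ((\1_A x)%:E * (normal_pdf m s x)%:E))%E.
Proof.
move=> mA; rewrite -ge0_integral_normal_prob//; last first.
  exact/measurable_EFinP.
by rewrite integral_indic// setIT.
Qed.

Lemma normal_prob_scale s y : 0 < s ->
  normal_prob 0 s `]-oo, (s * y)%R] = normal_prob 0 1 `]-oo, y].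
Proof.
move=> s0.
rewrite (normal_probE 0 s (measurable_itv `]-oo, (s * y)%R])).
rewrite (normal_probE 0 1 (measurable_itv `]-oo, y])).
pose h x : \bar R := ((\1_(`]-oo, (s * y)%R]%classic : set R) x)%:E * (normal_pdf 0 s x)%:E)%E.
have mh : measurable_fun setT h.
  by apply: emeasurable_funM; apply/measurable_EFinP => //; exact: measurable_normal_pdf.
have h0 x : (0 <= h x)%E by rewrite mule_ge0// lee_fin// normal_pdf_ge0.
have := ge0_integral_affine 0 (lt0r_neq0 s0) mh h0.
rewrite (gtr0_norm s0) => hE.
have -> : (\int[mu]_x h x = s%:E * \int[mu]_x h (s * x + 0)%R)%E.
  by rewrite hE muleA -EFinM mulfV ?gt_eqF// mul1e.
have s00 : 0 <= s := ltW s0.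
rewrite -ge0_integralZl_EFin//; last first.
  apply: measurableT_comp => //.
  by apply: measurable_funD => //; exact: measurable_funM.
apply: eq_integral => x _; rewrite addr0 /h muleCA -EFinM; congr (_%:E * _%:E)%E.
  by rewrite !indicE !mem_setE !in_itv/= ler_pM2l.
rewrite !normal_pdfE ?gt_eqF// (normal_peakE s0) !mulrA mulfV ?gt_eqF// mul1r.
congr (_ * expR _); rewrite !subr0; field; exact: lt0r_neq0.
Qed.

(** The peak 1 / sqrt (2 pi) of the density is at most 1, which is therefore a Lipschitz constant of
    the distribution function. *)
Lemma normal_prob_le y (e : R) : 0 <= e ->
  (normal_prob 0 1 `]-oo, (y + e)%R] <= normal_prob 0 1 `]-oo, y] + e%:E :> \bar R)%E.
Proof.
move=> e0.
have -> : `]-oo, (y + e)%R]%classic = `]-oo, y]%classic `|` `]y, (y + e)%R]%classic.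
  apply/seteqP; split => x/=; rewrite !in_itv/=.
    by have [xy|xy] := leP x y => ?; [left|right].
  by case=> [/le_trans->//|/andP[]//]; rewrite lerDl.
rewrite (le_trans (measureU2 _ _ _))// leeD2l//.
rewrite /normal_prob.
have -> : e%:E = (\int[mu]_(x in `]y, (y + e)%R]) (cst 1 x))%E.
  rewrite integral_cst//= mul1e lebesgue_measure_itv/= lte_fin ltrDl.
  case: ltgtP e0 => //= [_ _|<- _//]; by rewrite -EFinB addrC addKr.
apply: ge0_le_integral => //.
- by move=> x _; rewrite lee_fin normal_pdf_ge0.
- by apply/measurable_EFinP/measurable_funTS; exact: measurable_normal_pdf.
- move=> x _; rewrite lee_fin (le_trans (normal_pdf_ub _ _ _))//.
  have pi2 : 1 <= pi *+ 2 :> R by have := @pi_ge2 R; rewrite mulr2n; lra.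
  rewrite /normal_peak expr1n mul1r invf_le1 ?sqrtr_gt0; last lra.
  by rewrite -[leLHS]sqrtr1 ler_sqrt; lra.
Qed.

Lemma integral_expRN : (\int[mu]_(x in `[0%R, +oo[) (expR (- x))%:E = 1)%E.
Proof.
rewrite -(integral_exponential_pdf (@ltr01 R)) integral_mkcond.
apply: eq_integral => x _; rewrite /patch; case: ifPn => xp.
  by rewrite exponential_pdfE ?mulN1r ?mul1r//; move: xp; rewrite inE/= in_itv/= andbT.
rewrite lt0_exponential_pdf// ltNge; move: xp; apply: contra => x0.
by rewrite inE/= in_itv/= x0.
Qed.

Let c : R := normal_peak 1.

Let pdf1E x : normal_pdf 0 1 x = c * expR (- (x ^+ 2 / 2)).
Proof.
rewrite normal_pdfE ?oner_neq0// /normal_fun subr0 expr1n.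
by congr (_ * expR _); rewrite mulNr.
Qed.

Let c_gt0 : 0 < c. Proof. by apply: normal_peak_gt0; rewrite oner_neq0. Qed.

Let cpdf : continuous (normal_pdf 0 1 : R -> R).
Proof. exact/continuous_normal_pdf/oner_neq0. Qed.

(** From (x - 2)^2 >= 0. The decay is split into two factors [expR (- x)]: one absorbs a power of
    [x], the other still tends to 0 or is integrated. *)
Let pdf1_le x : normal_pdf 0 1 x <= c * (expR 2 * expR (- x) * expR (- x)).
Proof.
rewrite pdf1E ler_pM2l// -!expRD ler_expR.
have := sqr_ge0 (x - 2); lra.
Qed.

Lemma integral_normal_even (h : R -> R) : continuous h ->
  (forall x, 0 <= h x) -> (forall x, h (- x) = h x) ->
  (\int[normal_prob 0 1]_x (h x)%:E =
   2%:E * \int[mu]_(x in `[0%R, +oo[) (h x * normal_pdf 0 1 x)%:E)%E.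
Proof.
move=> ch h0 hN; rewrite ge0_integral_normal_prob//; last first.
  by apply/measurable_EFinP; exact: continuous_measurable_fun.
under eq_integral do rewrite -EFinM.
rewrite (@ge0_symfun_integralT R (fun x => h x * normal_pdf 0 1 x)).
- by rewrite set_itvcy.
- by move=> x; rewrite mulr_ge0// normal_pdf_ge0.
- by move=> x; apply: cvgM; [exact: ch|exact: cpdf].
- by move=> x /=; rewrite hN !pdf1E sqrrN.
Qed.

Let is_derive_pdf1 (x : R) : is_derive x 1 (fun x : R => c * expR (- (x ^+ 2 / 2)))
  (- (x * normal_pdf 0 1 x)).
Proof.
rewrite pdf1E.
have h : is_derive x 1 (fun x : R => - (x ^+ 2 / 2)) (- x).
  apply: is_derive_eq; rewrite !scaler1 scaler0 scaler0 add0r /GRing.scale/=.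
  by field.
have hc : is_derive x 1 (expR \o (fun x : R => - (x ^+ 2 / 2)))
  (expR (- (x ^+ 2 / 2)) * - x) by exact: is_derive1_comp.
have -> : - (x * (c * expR (- (x ^+ 2 / 2)))) = c *: (expR (- (x ^+ 2 / 2)) * - x).
  by rewrite /GRing.scale/=; ring.
exact: is_deriveZ.
Qed.

Let cvg_pdf1 : x * (c * expR (- (x ^+ 2 / 2))) @[x --> +oo] --> (0 : R).
Proof.
apply: (@squeeze_cvgr _ _ _ _ (cst 0) (fun x => c * expR 2 * expR (- x))).
- near=> x.
  have x0 : 0 <= x by near: x; exact: nbhs_pinfty_ge.
  rewrite mulr_ge0 ?mulr_ge0 ?expR_ge0 ?(ltW c_gt0)//=.
  rewrite -pdf1E (le_trans (ler_wpM2l x0 (pdf1_le x)))//.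
  have xe : x * expR (- x) <= 1.
    rewrite expRN ler_pdivrMr ?expR_gt0// mul1r.
    by have := expR_ge1Dx x; lra.
  have k0 : 0 <= c * expR 2 * expR (- x) by rewrite !mulr_ge0 ?expR_ge0// ltW.
  have := ler_wpM2l k0 xe; rewrite mulr1; apply: le_trans.
  by rewrite le_eqVlt; apply/orP; left; apply/eqP; ring.
- exact: cvg_cst.
- rewrite -[X in _ --> X](mulr0 (c * expR 2)).
  by apply: cvgM; [exact: cvg_cst|exact: cvgr_expR].
Unshelve. all: by end_near. Qed.

Lemma normal_prob_moment2 : (\int[normal_prob 0 1]_x (x ^+ 2)%:E = 1 :> \bar R)%E.
Proof.
rewrite (@integral_normal_even (fun x => x ^+ 2)); last 3 first.
- exact: exprn_continuous.
- by move=> x; exact: sqr_ge0.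
- by move=> x; rewrite sqrrN.
set I2 : \bar R := (\int[mu]_(x in _) _)%E.
pose I0 := (\int[mu]_(x in `[0%R, +oo[) (normal_pdf 0 1 x)%:E : \bar R)%E.
pose K := c * expR 1.
have K0 : 0 <= K by rewrite mulr_ge0 ?expR_ge0// ltW.
have mpdf : measurable_fun `[(0 : R), +oo[ (EFin \o normal_pdf 0 1).
  by apply/measurable_EFinP/measurable_funTS; exact: measurable_normal_pdf.
have I0E : (2%:E * I0 = 1)%E.
  have := @integral_normal_even (cst 1) (@cst_continuous _ _ _) (fun=> ler01) (fun=> erefl).
  rewrite (integral_probability1 (normal_prob (0 : R) 1)) => ->.
  have -> // : (\int[mu]_(x in `[0%R, +oo[) (cst 1%R x * normal_pdf 0 1 x)%:E = I0)%E.
  by apply: eq_integral => x _; rewrite mul1r.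
(* Integration by parts: x^2 * pdf - pdf is the derivative of - x * pdf, but it changes sign. The
   fundamental theorem applied below is for nonnegative integrands, so [K * expR (- x)], which
   dominates the density and has integral [K], is added and cancelled at the end. *)
pose f1 x := x ^+ 2 * normal_pdf 0 1 x - normal_pdf 0 1 x + K * expR (- x).
have f10 x : 0 <= f1 x.
  have := mulr_ge0 (sqr_ge0 x) (normal_pdf_ge0 0 1 x); rewrite /f1.
  suff : normal_pdf 0 1 x <= K * expR (- x) by lra.
  rewrite pdf1E /K -mulrA ler_pM2l// -expRD ler_expR.
  by have := sqr_ge0 (x - 1); lra.
have cf1 : continuous f1.
  move=> x; apply: cvgD; last first.
    apply: cvgM; first exact: cvg_cst.
    apply: (cvg_comp _ _ (cvgN cvg_id)); exact: continuous_expR.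
  apply: cvgB; last exact: cpdf.
  by apply: cvgM; [exact: exprn_continuous|exact: cpdf].
pose F x := - (x * (c * expR (- (x ^+ 2 / 2)))) - K * expR (- x).
have dF (x : R) : is_derive x 1 F (f1 x).
  have h := is_derive_pdf1 x.
  have hN : is_derive x 1 (fun x : R => expR (- x)) (- expR (- x)).
    rewrite -mulrN1; exact: (@is_derive1_comp _ expR -%R).
  apply: is_derive_eq.
  by rewrite /f1 pdf1E /GRing.scale/=; ring.
have mf1 : measurable_fun `[(0 : R), +oo[ (EFin \o f1).
  by apply/measurable_EFinP/measurable_funTS; exact: continuous_measurable_fun.
have cF : continuous F.
  by move=> x; apply/differentiable_continuous/derivable1_diffP; case: (dF x).
have intf1 : (\int[mu]_(x in `[0%R, +oo[) (f1 x)%:E = K%:E)%E.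
  rewrite (@ge0_continuous_FTC2y _ f1 F 0 0)//.
  - by rewrite /F mul0r oppr0 sub0r expR0 mulr1 EFinN oppeK add0e.
  - exact: continuous_subspaceT.
  - rewrite -[X in _ --> X](subr0 0) -{1}oppr0 -[X in _ - X](mulr0 K).
    by apply: cvgB; [exact: cvgN|apply: cvgM; [exact: cvg_cst|exact: cvgr_expR]].
  - exact/cvg_at_right_filter/cF.
  - by move=> x _; rewrite derive1E; case: (dF x).
have mexp : measurable_fun `[(0 : R), +oo[ (fun x : R => (expR (- x))%:E).
  by apply/measurable_EFinP/measurable_funTS; apply: measurableT_comp.
have key : (K%:E + I0 = I2 + K%:E)%E.
  rewrite -{1}intf1 -[in RHS](mule1 K%:E) -integral_expRN -ge0_integralD//; last 2 first.
  - by move=> x _; rewrite lee_fin.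
  - by move=> x _; rewrite lee_fin normal_pdf_ge0.
  rewrite -ge0_integralZl_EFin// /I2 -ge0_integralD//.
  - apply: eq_integral => x _; rewrite -EFinM -!EFinD; congr EFin.
    by rewrite /f1; ring.
  - by move=> x _; rewrite lee_fin mulr_ge0 ?sqr_ge0 ?normal_pdf_ge0.
  - apply/measurable_EFinP/measurable_funTS/measurable_funM => //.
    exact: measurable_normal_pdf.
  - by move=> x _; rewrite mule_ge0 ?lee_fin ?expR_ge0.
  - exact: emeasurable_funM.
have -> // : I2 = I0.
have Kf : K%:E \is a fin_num by [].
by rewrite -[LHS](addeK I2 Kf) -key [(K%:E + _)%E]addeC addeK.
Qed.

Lemma normal_prob_moment3 :
  (\int[normal_prob 0 1]_x (`|x| ^+ 3)%:E < +oo :> \bar R)%E.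
Proof.
rewrite (@integral_normal_even (fun x => `|x| ^+ 3)); last 3 first.
- move=> x.
  exact: (continuous_comp (@norm_continuous _ R^o x) (@exprn_continuous _ 3 _)).
- by move=> x; rewrite exprn_ge0.
- by move=> x; rewrite normrN.
have K0 : 0 <= c * 6 * expR 2 by rewrite !mulr_ge0 ?expR_ge0// ltW.
rewrite lte_mul_pinfty//.
apply: (@le_lt_trans _ _ (\int[mu]_(x in `[0%R, +oo[) ((c * 6 * expR 2)%:E * (expR (- x))%:E))%E).
  apply: ge0_le_integral => //.
  - by move=> x _; rewrite lee_fin mulr_ge0 ?exprn_ge0 ?normal_pdf_ge0.
  - apply/measurable_EFinP/measurable_funTS/measurable_funM.
      by apply: measurable_funX; exact: normr_measurable.
    exact: measurable_normal_pdf.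
  - apply/measurable_EFinP/measurable_funTS/measurable_funM => //.
    exact: measurableT_comp.
  - move=> x /=; rewrite in_itv/= andbT => x0; rewrite -EFinM lee_fin ger0_norm//.
    rewrite (le_trans (ler_wpM2l (exprn_ge0 _ x0) (pdf1_le x)))//.
    have xe : x ^+ 3 * expR (- x) <= 6.
      rewrite expRN ler_pdivrMr ?expR_gt0//.
      by have := @expR_ge1Dxn R x 2 x0; rewrite (_ : 3`! = 6)%N//; lra.
    have k0 : 0 <= c * expR 2 * expR (- x) by rewrite !mulr_ge0 ?expR_ge0// ltW.
    have := ler_wpM2l k0 xe; set a := expR 2; set b := expR (- x).
    by move: (x : R) => y; lra.
rewrite ge0_integralZl_EFin//.
- by rewrite integral_expRN mule1 ltry.
- by apply/measurable_EFinP/measurable_funTS; exact: measurableT_comp.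
Qed.

(** Reflection exchanges the positive and negative parts of the identity; their integrals may be
    subtracted because the third moment makes them finite. *)
Lemma normal_prob_mean0 : (\int[normal_prob 0 1]_x x%:E = 0 :> \bar R)%E.
Proof.
have mE : measurable_fun setT (EFin : R -> \bar R) by exact/measurable_EFinP.
have iE : (normal_prob (0 : R) 1).-integrable setT (EFin : R -> \bar R).
  exact: (integrable_pow_le3 normal_prob_moment3 (_ : 1 <= 3)%N).
have pn : ((EFin : R -> \bar R)^\- = (EFin : R -> \bar R)^\+ \o -%R)%E.
  by apply/funext => x; rewrite /= funenegE funeposE EFinN.
rewrite integralE pn.
have -> : (\int[normal_prob 0 1]_x ((EFin : R -> \bar R)^\+ \o -%R) x =
           \int[normal_prob 0 1]_x (EFin : R -> \bar R)^\+ x :> \bar R)%E.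
  apply: normal_prob_opp; rewrite ?oner_neq0//.
  exact: measurable_funepos.
rewrite subee//.
exact: integrable_fin_num (integrable_funepos measurableT iE).
Qed.

End normal_distribution.

(** * Lindeberg's method *)

Section logistic.
Context {R : realType}.
Implicit Types u h t : R.

Definition logistic u : R := (1 + expR u)^-1.

Let expR1_gt0 u : 0 < 1 + expR u. Proof. by rewrite addr_gt0 ?expR_gt0. Qed.

Lemma logistic_gt0 u : 0 < logistic u.
Proof. by rewrite invr_gt0. Qed.

Lemma logistic_lt1 u : logistic u < 1.
Proof. by rewrite invf_lt1// ltrDl expR_gt0. Qed.

Lemma continuous_logistic : continuous logistic.
Proof.
move=> u; apply: cvgV; first by rewrite gt_eqF.
by apply: cvgD; [exact: cvg_cst|exact: continuous_expR].
Qed.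

(** The first three derivatives [p], [q], [r] of [logistic]. As [logistic] solves l' = l^2 - l, they
    are polynomials in [logistic u], so that bounding them is a matter of polynomials on ]0, 1[. *)
Let p u : R := logistic u ^+ 2 - logistic u.
Let q u : R := (2 * logistic u - 1) * p u.
Let r u : R := p u * (6 * p u + 1).

Let is_derive_logistic u : is_derive u 1 logistic (p u).
Proof.
have h : is_derive u 1 (cst 1 + expR : R -> R) (0 + expR u) by exact: is_deriveD.
have n0 : (cst 1 + expR : R -> R) u != 0 by rewrite gt_eqF// expR1_gt0.
have -> : p u = - ((cst 1 + expR : R -> R) u) ^- 2 *: (0 + expR u).
  have := expR1_gt0 u; rewrite /p /logistic /GRing.scale/= !fctE/=.
  by move: (expR u) => y y0; field; rewrite gt_eqF.
exact: is_deriveV.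
Qed.

Let is_derive_p u : is_derive u 1 p (q u).
Proof.
have h := is_derive_logistic u.
have : is_derive u 1 (logistic * logistic - logistic)
  (logistic u *: p u + logistic u *: p u - p u) by exact: is_deriveB.
have -> : logistic * logistic - logistic = p.
  by apply/funext => x; rewrite /p expr2.
have -> // : logistic u *: p u + logistic u *: p u - p u = q u.
by rewrite /q /GRing.scale/=; ring.
Qed.

Let is_derive_q u : is_derive u 1 q (r u).
Proof.
have h := is_derive_logistic u; have hp := is_derive_p u.
have hl : is_derive u 1 (2 *: logistic - cst 1) (2 *: p u - 0).
  exact: is_deriveB.
have : is_derive u 1 ((2 *: logistic - cst 1) * p)
  ((2 *: logistic - cst 1) u *: q u + p u *: (2 *: p u - 0)).
  exact: is_deriveM.
have -> : (2 *: logistic - cst 1) * p = q.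
  by apply/funext => x; rewrite /q.
have -> // : (2 *: logistic - cst 1) u *: q u + p u *: (2 *: p u - 0) = r u.
by rewrite /r /q /p /GRing.scale/= !fctE/= /GRing.scale/=; ring.
Qed.

Let norm_r_le1 u : `|r u| <= 1.
Proof.
have l0 := logistic_gt0 u; have l1 := logistic_lt1 u.
have p0 : p u <= 0 by rewrite /p; nra.
have p1 : - (1 / 4) <= p u by rewrite /p; have := sqr_ge0 (logistic u - 1 / 2); nra.
by rewrite ler_norml /r; apply/andP; split; nra.
Qed.

(** By the mean value theorem. The factor 1 / (k + 1) that integration would give is forgone, since
    only the order of the bound matters. *)
Let ler_pow_primitive (g g' : R -> R) (k : nat) :
  (forall t, is_derive t 1 g (g' t)) -> g 0 = 0 ->
  (forall t, `|g' t| <= `|t| ^+ k) -> forall t, `|g t| <= `|t| ^+ k.+1.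
Proof.
move=> dg g0 g'k t.
have cg : continuous g.
  by move=> x; apply/differentiable_continuous/derivable1_diffP; case: (dg x).
have [t0|t0|->] := ltgtP t 0; last by rewrite g0 normr0 exprn_ge0.
- have [c] := MVT t0 (fun x _ => dg x) (continuous_subspaceT cg).
  rewrite in_itv/= g0 !sub0r mulrN => /andP[tc c0] /oppr_inj ->.
  rewrite normrM exprSr ler_wpM2r// (le_trans (g'k c))//.
  by rewrite lerXn2r ?nnegrE// !ltr0_norm ?lerN2 ?ltW//.
- have [c] := MVT t0 (fun x _ => dg x) (continuous_subspaceT cg).
  rewrite in_itv/= g0 !subr0 => /andP[c0 ct] ->.
  rewrite normrM exprSr ler_wpM2r// (le_trans (g'k c))//.
  by rewrite lerXn2r ?nnegrE// !gtr0_norm ?ltW//.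
Qed.

Let is_derive_addl (f : R -> R) (df u h : R) : is_derive (u + h) 1 f df ->
  is_derive h 1 (fun t => f (u + t)) df.
Proof.
move=> hf; have hu : is_derive h 1 (cst u + id : R -> R) (0 + 1) by exact: is_deriveD.
by rewrite -[df]mulr1 -{2}[1]add0r; exact: (@is_derive1_comp _ f (cst u + id)).
Qed.

(** The bound 1 on the third derivative is integrated three times. The coefficients stay
    existential: the replacement only requires them to be the same for both laws. *)
Lemma logistic_taylor2 u : exists a b, forall h,
  `|logistic (u + h) - (logistic u + a * h + b * h ^+ 2)| <= `|h| ^+ 3.
Proof.
exists (p u), (q u / 2) => h.
pose g2 t := q (u + t) - q u.
pose g1 t := p (u + t) - p u - q u * t.
pose g0 t := logistic (u + t) - logistic u - p u * t - q u / 2 * t ^+ 2.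
have dq t := is_derive_addl (is_derive_q (u + t)).
have dp t := is_derive_addl (is_derive_p (u + t)).
have dl t := is_derive_addl (is_derive_logistic (u + t)).
have e2 : forall t, `|g2 t| <= `|t| ^+ 1.
  apply: (ler_pow_primitive (g' := fun t => r (u + t))) => [t||t].
  - by apply: is_derive_eq; rewrite subr0.
  - by rewrite /g2 addr0 subrr.
  - by rewrite expr0.
have e1 : forall t, `|g1 t| <= `|t| ^+ 2.
  refine (@ler_pow_primitive g1 g2 1 _ _ e2) => [t|].
  - by apply: is_derive_eq; rewrite /g2 /GRing.scale/=; ring.
  - by rewrite /g1 addr0 subrr mulr0 subr0.
have e0 : forall t, `|g0 t| <= `|t| ^+ 3.
  refine (@ler_pow_primitive g0 g1 2 _ _ e1) => [t|].
  - by apply: is_derive_eq; rewrite /g1 /GRing.scale/=; field.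
  - by rewrite /g0 addr0 subrr expr0n /= !mulr0 !subr0.
rewrite !opprD !addrA; exact: e0 h.
Qed.

End logistic.

Lemma Rintegral_probability_cst d (T : measurableType d) (R : realType)
  (m : probability T R) (r : R) : \int[m]_x r = r.
Proof. by rewrite Rintegral_cst//= [X in fine X]probability_setT mulr1. Qed.

(** * Convolution operators on bounded test functions *)

Section averaging.
Context {R : realType}.
Local Notation prob := (probability (measurableTypeR R) R).
Implicit Types (m : prob) (f g : R -> R) (y : R).

(** This class is stable under translation and [avg]. Its bounds make integrability automatic, and
    its sign makes Tonelli's theorem applicable. *)
Definition unit_fun f := measurable_fun setT f /\ forall x, 0 <= f x <= 1.

Definition avg m f y : R := \int[m]_x f (y + x).

Lemma unit_fun_shift f y : unit_fun f -> unit_fun (fun x => f (y + x)).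
Proof.
case=> mf f01; split => [|x]; last exact: f01.
by apply: measurableT_comp => //; exact: measurable_funD.
Qed.

Lemma integrable_unit_fun m f : unit_fun f -> m.-integrable setT (EFin \o f).
Proof.
case=> mf f01; apply: (@le_integrable _ _ _ m _ measurableT _ (cst 1%E)).
- exact/measurable_EFinP.
- move=> x _; have /andP[f0 f1] := f01 x.
  by rewrite /= lee_fin normr1 ger0_norm.
- exact: finite_measure_integrable_cst.
Qed.

Lemma avgE m f y : unit_fun f -> (avg m f y)%:E = (\int[m]_x (f (y + x))%:E)%E.
Proof.
move=> uf; rewrite /avg /Rintegral fineK//.
exact: integrable_fin_num (integrable_unit_fun m (unit_fun_shift y uf)).
Qed.

Lemma unit_fun_avg m f : unit_fun f -> unit_fun (avg m f).
Proof.
move=> uf; case: (uf) => mf f01; split.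
  apply/measurable_EFinP.
  rewrite (_ : _ \o _ = fun y => \int[m]_x (f (y + x))%:E)%E; last first.
    by apply/funext => y; exact: avgE.
  apply: (@measurable_fun_fubini_tonelli_F _ _ _ _ _ m
      (fun yx : R * R => (f (yx.1 + yx.2))%:E)) => //=.
    apply/measurable_EFinP; apply: measurableT_comp => //.
    exact: measurable_funD.
  by move=> yx; rewrite lee_fin; case/andP: (f01 (yx.1 + yx.2)).
move=> y; rewrite -!lee_fin avgE//; apply/andP; split.
  by apply: integral_ge0 => x _; rewrite lee_fin; case/andP: (f01 (y + x)).
rewrite -[leRHS](integral_probability1 m); apply: ge0_le_integral => //.
- by move=> x _; rewrite lee_fin; case/andP: (f01 (y + x)).
- by apply/measurable_EFinP; case: (unit_fun_shift y uf).
- by move=> x _; rewrite lee_fin; case/andP: (f01 (y + x)).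
Qed.

Lemma avgC m1 m2 f : unit_fun f -> avg m1 (avg m2 f) = avg m2 (avg m1 f).
Proof.
move=> uf; apply/funext => y; apply: EFin_inj.
rewrite !avgE; try exact: unit_fun_avg.
under eq_integral do rewrite avgE//.
under [RHS]eq_integral do rewrite avgE//.
rewrite (fubini_tonelli (m1 := m1) (m2 := m2)
  (fun x12 : R * R => (f (y + x12.1 + x12.2))%:E)).
- by apply: eq_integral => z _; apply: eq_integral => x _; rewrite addrAC.
- apply/measurable_EFinP; apply: (measurableT_comp uf.1).
  by apply: measurable_funD => //; exact: measurable_funD.
- by move=> x; rewrite lee_fin; case/andP: (uf.2 (y + x.1 + x.2)).
Qed.

Lemma avg_dist m f g (e : R) : unit_fun f -> unit_fun g ->
  (forall y, `|f y - g y| <= e) -> forall y, `|avg m f y - avg m g y| <= e.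
Proof.
move=> uf ug fg y.
have intf := integrable_unit_fun m (unit_fun_shift y uf).
have intg := integrable_unit_fun m (unit_fun_shift y ug).
have intB : m.-integrable setT (EFin \o (fun x => f (y + x) - g (y + x))).
  exact: (integrableB measurableT intf intg).
rewrite /avg -RintegralB//.
apply: (le_trans (le_normr_Rintegral measurableT intB)).
have -> : e = \int[m]_x e by rewrite Rintegral_probability_cst.
apply: le_Rintegral => //.
- exact: integrable_norm.
- exact: finite_measure_integrable_cst.
Qed.

Lemma unit_fun_iter_avg m f n : unit_fun f -> unit_fun (iter n (avg m) f).
Proof. by move=> uf; elim: n => //= n; exact: unit_fun_avg. Qed.

(** Writing A and B for the two operators, commutation gives A^(n+1) f - B^(n+1) f = A (A^n f - B^n
    f) + B^n (A f - B f). By contraction the first term inherits the bound at n and the second is at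
    most [e]. *)
Lemma iter_avg_dist m1 m2 f (e : R) n : unit_fun f ->
  (forall y, `|avg m1 f y - avg m2 f y| <= e) ->
  forall y, `|iter n (avg m1) f y - iter n (avg m2) f y| <= n%:R * e.
Proof.
move=> uf m12; elim: n => [|n IH] y; first by rewrite subrr normr0 mul0r.
have comm k : avg m1 (iter k (avg m2) f) = iter k (avg m2) (avg m1 f).
  by elim: k => //= k <-; rewrite avgC//; exact: unit_fun_iter_avg.
have dist k z : `|iter k (avg m2) (avg m1 f) z - iter k (avg m2) (avg m2 f) z| <= e.
  elim: k z => [|k IHk] z /=; first exact: m12.
  by apply: avg_dist => //; apply: unit_fun_iter_avg; exact: unit_fun_avg.
rewrite /= -(subrKA (avg m1 (iter n (avg m2) f) y)) (le_trans (ler_normD _ _))//.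
rewrite -natr1 mulrDl mul1r lerD//.
  by apply: avg_dist => //; exact: unit_fun_iter_avg.
by rewrite comm -iterS iterSr.
Qed.

(** The main term [f y + b] sees [m] only through its mean and variance, which are prescribed, so it
    is common to all the laws compared; the law enters the error by its third moment. *)
Lemma avg_taylor m f y (a b K : R) : unit_fun f ->
  (forall h, `|f (y + h) - (f y + a * h + b * h ^+ 2)| <= K * `|h| ^+ 3) ->
  (\int[m]_x x%:E = 0)%E -> (\int[m]_x (x ^+ 2)%:E = 1)%E ->
  (\int[m]_x (`|x| ^+ 3)%:E < +oo)%E ->
  `|avg m f y - (f y + b)| <= K * \int[m]_x (`|x| ^+ 3).
Proof.
move=> uf fab m1 m2 m3.
have i1 := integrable_pow_le3 m3 (isT : 1 <= 3)%N.
have i2 := integrable_pow_le3 m3 (isT : 2 <= 3)%N.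
have i3 : m.-integrable setT (EFin \o (fun x => `|x| ^+ 3)).
  have := integrable_pow_le3 m3 (isT : 3 <= 3)%N => /integrable_norm.
  by apply: eq_integrable => // x _; rewrite /= normrX.
have intf := integrable_unit_fun m (unit_fun_shift y uf).
have i0 : m.-integrable setT (EFin \o cst (f y)) by exact: finite_measure_integrable_cst.
have ia : m.-integrable setT (EFin \o (fun x => a * x)).
  exact: (integrableZl measurableT a i1).
have ib : m.-integrable setT (EFin \o (fun x => b * x ^+ 2)).
  exact: (integrableZl measurableT b i2).
have i0a : m.-integrable setT (EFin \o (fun x => f y + a * x)).
  exact: (integrableD measurableT i0 ia).
have iT : m.-integrable setT (EFin \o (fun x => f y + a * x + b * x ^+ 2)).
  exact: (integrableD measurableT i0a ib).
have iB : m.-integrable setT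
    (EFin \o (fun x => f (y + x) - (f y + a * x + b * x ^+ 2))).
  exact: (integrableB measurableT intf iT).
have -> : f y + b = \int[m]_x (f y + a * x + b * x ^+ 2).
  rewrite RintegralD// RintegralD// !RintegralZl//.
  rewrite Rintegral_probability_cst.
  by rewrite /Rintegral m1 m2 mulr0 addr0 mulr1.
rewrite /avg -RintegralB// -RintegralZl//.
apply: (le_trans (le_normr_Rintegral measurableT iB)).
apply: le_Rintegral => //.
- exact: integrable_norm.
- exact: (integrableZl measurableT K i3).
Qed.

End averaging.

Section gaussian_semigroup.
Context {R : realType}.
Local Notation prob := (probability (measurableTypeR R) R).
Implicit Types f : R -> R.

(** Parametrized by the variance, so that convolution adds parameters. *)
Definition gauss (v : R) : prob := normal_prob 0 (Num.sqrt v).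

Lemma avg_gauss (v1 v2 : R) f : 0 < v1 -> 0 < v2 -> unit_fun f ->
  avg (gauss v1) (avg (gauss v2) f) = avg (gauss (v1 + v2)) f.
Proof.
move=> v10 v20 uf; apply/funext => y; apply: EFin_inj.
apply: (etrans (avgE _ _ (unit_fun_avg _ uf))).
apply: etrans _ (esym (avgE _ _ uf)).
transitivity (\int[gauss v1]_x \int[gauss v2]_z (f (y + x + z))%:E)%E.
  by apply: eq_integral => x _; exact: avgE.
have mf : measurable_fun setT (fun x => (f (y + x))%:E).
  by apply/measurable_EFinP; case: (unit_fun_shift y uf).
have f0 x : (0 <= (f (y + x))%:E)%E by rewrite lee_fin; case/andP: (uf.2 (y + x)).
have s1 : 0 < Num.sqrt v1 by rewrite sqrtr_gt0.
have s2 : 0 < Num.sqrt v2 by rewrite sqrtr_gt0.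
have := normal_prob_convolution s1 s2 mf f0.
rewrite (sqr_sqrtr (ltW v10)) (sqr_sqrtr (ltW v20)).
apply: etrans.
by apply: eq_integral => x _; apply: eq_integral => z _; rewrite addrA.
Qed.

End gaussian_semigroup.

(** * From smooth test functions to distribution functions *)

Section lindeberg.
Context {R : realType}.
Local Notation prob := (probability (measurableTypeR R) R).
Implicit Types (f : R -> R) (c y : R).

(* A smooth decreasing approximation, at scale 1 / k, of the indicator of ]-oo, c]. *)
Definition step (k c x : R) : R := logistic (k * (x - c)).

Lemma unit_fun_step k c : unit_fun (step k c).
Proof.
split=> [|x]; last by rewrite !ltW ?logistic_gt0 ?logistic_lt1.
apply: (measurableT_comp (continuous_measurable_fun continuous_logistic)).
by apply: measurable_funM => //; exact: measurable_funB.
Qed.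

Lemma step_close (m1 m2 : prob) k c y : 0 <= k ->
  (\int[m1]_x x%:E = 0)%E -> (\int[m1]_x (x ^+ 2)%:E = 1)%E ->
  (\int[m1]_x (`|x| ^+ 3)%:E < +oo)%E ->
  (\int[m2]_x x%:E = 0)%E -> (\int[m2]_x (x ^+ 2)%:E = 1)%E ->
  (\int[m2]_x (`|x| ^+ 3)%:E < +oo)%E ->
  `|avg m1 (step k c) y - avg m2 (step k c) y| <=
  k ^+ 3 * (\int[m1]_x (`|x| ^+ 3) + \int[m2]_x (`|x| ^+ 3)).
Proof.
move=> k0 m11 m12 m13 m21 m22 m23.
have [a [b ab]] := logistic_taylor2 (k * (y - c)).
have fab h : `|step k c (y + h) - (step k c y + (k * a) * h + (k ^+ 2 * b) * h ^+ 2)|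
    <= k ^+ 3 * `|h| ^+ 3.
  have := ab (k * h); rewrite normrM (ger0_norm k0) [(k * `|h|) ^+ 3]exprMn.
  apply: le_trans; rewrite /step.
  have -> : k * (y + h - c) = k * (y - c) + k * h by ring.
  rewrite le_eqVlt; apply/orP; left; apply/eqP; congr (`|_|); ring.
have u := unit_fun_step k c.
have e1 := avg_taylor u fab m11 m12 m13.
have e2 := avg_taylor u fab m21 m22 m23.
rewrite mulrDr -(subrKA (step k c y + k ^+ 2 * b)).
rewrite (le_trans (ler_normD _ _))// lerD//.
by rewrite distrC.
Qed.

Lemma logistic_ge (x : R) : 1 - expR x <= logistic x.
Proof.
rewrite /logistic; have := expR_gt0 x; move: (expR x) => t t0.
rewrite -[leRHS]mul1r ler_pdivlMr ?addr_gt0//; nra.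
Qed.

Lemma logistic_le (x : R) : logistic x <= expR (- x).
Proof.
by rewrite /logistic expRN lef_pV2 ?posrE ?addr_gt0 ?expR_gt0// lerDr.
Qed.

Let prob_RintegralE (m : prob) c :
  fine (m `]-oo, c]%classic) = \int[m]_x \1_(`]-oo, c]%classic) x.
Proof. by rewrite /Rintegral integral_indic// setIT. Qed.

Let integrable_indic (m : prob) c :
  m.-integrable setT (EFin \o (\1_(`]-oo, c]%classic) : R -> R)).
Proof.
apply: (integrable_unit_fun m); split => [|x]; first exact: measurable_indic.
by rewrite indicE; case: (_ \in _); rewrite /= ?lexx ?ler01.
Qed.

(** At distance [e] from its center a step differs from the indicator by at most [expR (- (k * e))].
    Shifting the center by [e] to the right here, and to the left in [step_le_prob], sandwiches the
    distribution function between two smooth averages. *)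
Lemma prob_le_step (m : prob) k c (e : R) : 0 <= k ->
  fine (m `]-oo, c]%classic) <= avg m (step k (c + e)) 0 + expR (- (k * e)).
Proof.
move=> k0.
have u := integrable_unit_fun m (unit_fun_shift 0 (unit_fun_step k (c + e))).
have icst : m.-integrable setT (EFin \o cst (expR (- (k * e)))).
  exact: finite_measure_integrable_cst.
rewrite prob_RintegralE -[expR _](Rintegral_probability_cst m) /avg -RintegralD//.
apply: le_Rintegral; [by []|exact: integrable_indic|exact: (integrableD measurableT u icst)|].
move=> x _; rewrite add0r indicE mem_setE in_itv/=.
have [xc|_] := leP x c; last first.
  by rewrite addr_ge0 ?expR_ge0 ?ltW ?logistic_gt0.
rewrite -[true%:R]/(1 : R) -lerBlDr (le_trans _ (logistic_ge _))//.
by rewrite lerD2l lerN2 ler_expR -mulrN ler_wpM2l//; lra.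
Qed.

Lemma step_le_prob (m : prob) k c (e : R) : 0 <= k ->
  avg m (step k (c - e)) 0 <= fine (m `]-oo, c]%classic) + expR (- (k * e)).
Proof.
move=> k0.
have u := integrable_unit_fun m (unit_fun_shift 0 (unit_fun_step k (c - e))).
have icst : m.-integrable setT (EFin \o cst (expR (- (k * e)))).
  exact: finite_measure_integrable_cst.
have iind := integrable_indic m c.
rewrite prob_RintegralE -[expR _](Rintegral_probability_cst m) /avg -RintegralD//.
apply: le_Rintegral; [by []|exact: u|exact: (integrableD measurableT iind icst)|].
move=> x _; rewrite add0r indicE mem_setE in_itv/=.
have [xc|xc] := leP x c.
  by rewrite /= (le_trans (ltW (logistic_lt1 _)))// lerDl expR_ge0.
rewrite add0r (le_trans (logistic_le _))// ler_expR lerN2 ler_wpM2l//; lra.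
Qed.

(* Q n is the law of a sum of n independent variables of law m, and N v plays the
   part of the centered Gaussian law of variance v. *)
Lemma clt_cdf (N : R -> prob) (m : prob) (Q : nat -> prob) :
  (forall v1 v2 f, 0 < v1 -> 0 < v2 -> unit_fun f ->
    avg (N v1) (avg (N v2) f) = avg (N (v1 + v2)) f) ->
  (forall v y, 0 < v ->
    N v `]-oo, (Num.sqrt v * y)%R]%classic = N 1 `]-oo, y]%classic) ->
  (forall y (e : R), 0 <= e ->
    (N 1%R `]-oo, (y + e)%R]%classic <= N 1%R `]-oo, y]%classic + e%:E)%E) ->
  (\int[N 1%R]_x x%:E = 0)%E -> (\int[N 1%R]_x (x ^+ 2)%:E = 1)%E ->
  (\int[N 1%R]_x (`|x| ^+ 3)%:E < +oo)%E ->
  (\int[m]_x x%:E = 0)%E -> (\int[m]_x (x ^+ 2)%:E = 1)%E ->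
  (\int[m]_x (`|x| ^+ 3)%:E < +oo)%E ->
  (forall n f, unit_fun f -> avg (Q n) f 0 = iter n (avg m) f 0) ->
  forall e : R, 0 < e -> exists n0 : nat, forall n, (n0 <= n)%N -> forall y,
  `|fine (Q n `]-oo, (Num.sqrt n%:R * y)%R]%classic) - fine (N 1 `]-oo, y]%classic)| <= e.
Proof.
move=> Nconv Nscale Nle N1 N2 N3 m1 m2 m3 QE e e0.
have iterN n f : unit_fun f -> iter n.+1 (avg (N 1)) f = avg (N n.+1%:R) f.
  move=> uf; elim: n => // n IH.
  by rewrite iterS IH Nconv// ?ltr0n// -[in RHS]natr1 addrC.
set M := \int[m]_x (`|x| ^+ 3) + \int[N 1]_x (`|x| ^+ 3).
have M0 : 0 <= M by apply: addr_ge0; apply: Rintegral_ge0 => x _; exact: exprn_ge0.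
(* Error budget: [e / 4] for the replacements, [e / 8] for each of the two passages between step and
   indicator, and [d * 2 = e / 4] for the displacement of the threshold. The value of [k] gives
   [k * d = 8 / e], whence the bound on [expR (- (k * d))]. *)
pose d := e / 8; pose k := 64 / e ^+ 2.
have d0 : 0 < d by rewrite divr_gt0.
have k0 : 0 < k by rewrite divr_gt0// exprn_gt0.
have kd : expR (- (k * d)) <= e / 8.
  have -> : k * d = 8 / e by rewrite /k /d; field; rewrite gt_eqF.
  have e8 : 0 < 8 / e by rewrite divr_gt0.
  rewrite expRN -[leRHS]invrK lef_pV2 ?posrE ?expR_gt0 ?invr_gt0 ?divr_gt0//.
  by rewrite invfM invrK mulrC (le_trans _ (expR_ge1Dx _))// lerDr.
(* With s = sqrt n, the n replacements at steepness [k / s] cost n * (k / s)^3 * M = k^3 * M / s,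
   which is at most [e / 4] once [L <= s]. *)
pose L := 4 * k ^+ 3 * M / e.
have L0 : 0 <= L by rewrite !mulr_ge0 ?invr_ge0 ?exprn_ge0// ltW.
exists (Num.truncn (L ^+ 2)).+1 => -[//|n] nn0 y.
set s := Num.sqrt n.+1%:R.
have s0 : 0 < s by rewrite sqrtr_gt0 ltr0n.
have s2 : s ^+ 2 = n.+1%:R by rewrite sqr_sqrtr.
have Ls : L <= s.
  rewrite -(ger0_norm L0) -sqrtr_sqr ler_sqrt// (le_trans (ltW (truncnS_gt _)))//.
  by rewrite ler_nat.
have rate : n.+1%:R * ((k / s) ^+ 3 * M) <= e / 4.
  have -> : n.+1%:R * ((k / s) ^+ 3 * M) = k ^+ 3 * M / s.
    by rewrite -s2; field; rewrite gt_eqF.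
  by move: Ls; rewrite /L ler_pdivrMr// ler_pdivrMr//; lra.
have ks0 : 0 <= k / s by rewrite divr_ge0// ltW.
have kde : expR (- (k / s * (s * d))) <= e / 8.
  by rewrite (_ : k / s * (s * d) = k * d)//; field; rewrite gt_eqF.
have close c : `|avg (Q n.+1) (step (k / s) c) 0 - avg (N n.+1%:R) (step (k / s) c) 0| <= e / 4.
  rewrite QE; last exact: unit_fun_step.
  rewrite -iterN; last exact: unit_fun_step.
  apply: le_trans rate; apply: iter_avg_dist; first exact: unit_fun_step.
  by move=> z; exact: step_close.
have lip z : fine (N 1 `]-oo, (z + d * 2)%R]%classic) <= fine (N 1 `]-oo, z]%classic) + d * 2.
  have d20 : 0 <= d * 2 by rewrite mulr_ge0// ltW.
  by rewrite -lee_fin EFinD !fineK ?Nle ?fin_num_measure.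
have sN z : fine (N n.+1%:R `]-oo, (s * z)%R]%classic) = fine (N 1 `]-oo, z]%classic).
  by rewrite Nscale// ltr0n.
rewrite ler_distl; apply/andP; split.
- have h1 := step_le_prob (Q n.+1) (s * y) (s * d) ks0.
  have h2 := prob_le_step (N n.+1%:R) (s * (y - d * 2)) (s * d) ks0.
  have := close (s * y - s * d).
  rewrite (_ : s * (y - d * 2) + s * d = s * y - s * d) in h2; last by ring.
  rewrite sN in h2; have := lip (y - d * 2); rewrite subrK ler_norml.
  by rewrite /d in kde h1 h2 *; lra.
- have h1 := prob_le_step (Q n.+1) (s * y) (s * d) ks0.
  have h2 := step_le_prob (N n.+1%:R) (s * (y + d * 2)) (s * d) ks0.
  have := close (s * y + s * d).
  rewrite (_ : s * (y + d * 2) - s * d = s * y + s * d) in h2; last by ring.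
  rewrite sN in h2; have := lip y; rewrite ler_norml.
  by rewrite /d in kde h1 h2 *; lra.
Qed.

End lindeberg.

(** * Sums of independent variables *)

(** Dynkin's pi-lambda theorem: the events independent of [F] form a Dynkin system. *)
Lemma independent_g_sigma_algebra d (Omega : measurableType d) (R : realType)
    (P : probability Omega R) (G : set (set Omega)) (F : set Omega) :
  setI_closed G -> G `<=` measurable -> measurable F ->
  (forall A, G A -> P (A `&` F) = (P A * P F)%E) ->
  forall A, <<s G >> A -> P (A `&` F) = (P A * P F)%E.
Proof.
move=> GI Gm mF GF.
pose D := [set A | measurable A /\ P (A `&` F) = (P A * P F)%E].
suff : <<s G >> `<=` D by move=> GD A /GD[].
rewrite -setI_closed_g_dynkin_g_sigma_algebra//; apply: smallest_sub; last first.
  by move=> A GA; split; [exact: Gm|exact: GF].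
have finP A : measurable A -> P A \is a fin_num by move=> mA; exact: fin_num_measure.
split.
- by split=> //; rewrite setTI probability_setT mul1e.
- move=> A [mA AF]; split; first exact: measurableC.
  have mAF : measurable (A `&` F) by exact: measurableI.
  have FA : P (F `\` A) = (P F - P (A `&` F))%E.
    rewrite measureD//; first by rewrite (setIC F A).
    by rewrite (le_lt_trans (probability_le1 P mF)) ?ltry.
  rewrite setIC -setDE FA AF (probability_setC P mA).
  rewrite -(fineK (finP _ mA)) -(fineK (finP _ mF)) -EFinM -!EFinB -EFinM.
  by congr EFin; ring.
- move=> A tA DA; have mA n : measurable (A n) by case: (DA n).
  split; first exact: bigcup_measurable.
  rewrite setI_bigcupl !measure_bigcup//; last 2 first.
  - by move=> n _; exact: measurableI.
  - exact: trivIset_setIr.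
  have -> : (\sum_(i <oo | i \in setT) P (A i `&` F) =
      \sum_(i <oo | i \in setT) ((fine (P F))%:E * P (A i)))%E.
    by apply: eq_eseriesr => i _; rewrite (DA i).2 muleC fineK// finP.
  by rewrite nneseriesZl// fineK ?finP// muleC.
Qed.

Section law.
Context d (Omega : measurableType d) (R : realType) (P : probability Omega R).

(* The distribution of Y, retyped on measurableTypeR R, where normal_prob lives. *)
Let copy (Y : {RV P >-> R}) : Omega -> measurableTypeR R := Y.

Let measurable_copy Y : measurable_fun setT (copy Y).
Proof. by move=> mT B mB; exact: measurable_funP. Qed.

HB.instance Definition _ Y := isMeasurableFun.Build _ _ _ _ (copy Y) (measurable_copy Y).

Definition law (Y : {RV P >-> R}) : probability (measurableTypeR R) R :=
  distribution P (copy Y).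

Lemma ge0_integral_law (Y : {RV P >-> R}) (f : R -> \bar R) :
  measurable_fun setT f -> (forall x, (0 <= f x)%E) ->
  (\int[law Y]_x f x = \int[P]_w f (Y w))%E.
Proof. by move=> mf f0; exact: (ge0_integral_distribution (copy Y)). Qed.

Lemma integral_law_integrable (Y : {RV P >-> R}) (f : R -> \bar R) :
  measurable_fun setT f -> P.-integrable setT (f \o Y) ->
  (\int[law Y]_x f x = \int[P]_w f (Y w))%E.
Proof. by move=> mf iY; exact: (integral_distribution (X := copy Y)). Qed.

End law.
Arguments law {d Omega R} P Y.

Section independent_sums.
Context d (Omega : measurableType d) (R : realType) (P : probability Omega R).
Variable X : nat -> {RV P >-> R}.
Hypothesis indX : mutually_independent X.

Definition psum (n : nat) (w : Omega) : R := \sum_(i < n) X i w.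

Lemma psum0 w : psum 0 w = 0. Proof. exact: big_ord0. Qed.

Lemma psumS n w : psum n.+1 w = psum n w + X n w.
Proof. by rewrite /psum big_ord_recr. Qed.

Let measurable_psum n : measurable_fun setT (psum n).
Proof.
elim: n => [|n IH].
  by rewrite (_ : psum 0 = cst 0)//; apply/funext => w; exact: psum0.
rewrite (_ : psum n.+1 = psum n \+ X n); first exact: measurable_funD.
by apply/funext => w; exact: psumS.
Qed.

HB.instance Definition _ n := isMeasurableFun.Build _ _ _ _ (psum n) (measurable_psum n).

(** A pi-system generating the sigma-algebra of the first [n] variables. Mutual independence yields
    the product formula on it, and Dynkin's argument extends that formula to the events on
    [psum n]. *)
Let cylinder n := [set A : set Omega | exists B : nat -> set R,
  (forall i, measurable (B i)) /\ A = \bigcap_(i in [set` iota 0 n]) X i @^-1` B i].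

Let measurable_X i (B : set R) : measurable B -> measurable (X i @^-1` B).
Proof. by move=> mB; rewrite -[X in measurable X]setTI; exact: measurable_funP. Qed.

Let cylinder_setI n : setI_closed (cylinder n).
Proof.
move=> _ _ [B [mB ->]] [C [mC ->]]; exists (fun i => B i `&` C i); split.
  by move=> i; exact: measurableI.
by rewrite -bigcapI.
Qed.

Let cylinder_measurable n : cylinder n `<=` measurable.
Proof.
move=> _ [B [mB ->]]; rewrite bigcap_seq.
by apply: bigsetI_measurable => i _; exact: measurable_X.
Qed.

Let cylinder_independent n (C : set R) A : measurable C -> cylinder n A ->
  P (A `&` X n @^-1` C) = (P A * P (X n @^-1` C))%E.
Proof.
move=> mC [B [mB ->]].
pose D i := if i == n then C else B i.
have mD i : measurable (D i) by rewrite /D; case: ifP.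
have nn : n \notin iota 0 n by rewrite mem_iota add0n ltnn andbF.
have eqD i : i \in iota 0 n -> D i = B i.
  by rewrite /D; case: eqP => // -> /negPn; rewrite nn.
have := indX (s := n :: iota 0 n) _ mD; rewrite /= nn iota_uniq => /(_ isT).
rewrite bigcap_seq !big_cons -bigcap_seq.
have -> : \bigcap_(i in [set` iota 0 n]) X i @^-1` D i =
          \bigcap_(i in [set` iota 0 n]) X i @^-1` B i.
  by apply: eq_bigcapr => i /= /eqD ->.
have -> : (\prod_(i <- iota 0 n) P (X i @^-1` D i) =
           P (\bigcap_(i in [set` iota 0 n]) X i @^-1` B i))%E.
  rewrite indX ?iota_uniq//; apply: eq_big_seq => i /eqD ->//.
by rewrite /D eqxx setIC muleC.
Qed.

Let psum_preimage n (B : set R) : measurable B -> <<s cylinder n >> (psum n @^-1` B).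
Proof.
move=> mB.
suff : measurable_fun setT (psum n : g_sigma_algebraType (cylinder n) -> R).
  by move=> /(_ measurableT _ mB); rewrite setTI.
have mX i : (i < n)%N ->
    measurable_fun setT (X i : g_sigma_algebraType (cylinder n) -> R).
  move=> ilt _ C mC; rewrite setTI; apply: sub_gen_smallest.
  exists (fun j => if j == i then C else setT); split.
    by move=> j; case: ifP.
  apply/seteqP; split => [w Xw j _ /=|w].
    by case: eqP => // ->.
  by move=> /(_ i); rewrite /= mem_iota ilt eqxx; exact.
suff psum_le k : (k <= n)%N ->
    measurable_fun setT (psum k : g_sigma_algebraType (cylinder n) -> R).
  exact: psum_le.
elim: k => [_|k IH kn].
  by rewrite (_ : psum 0 = cst 0)//; apply/funext => w; exact: psum0.
rewrite (_ : psum k.+1 = psum k \+ X k); last by apply/funext => w; exact: psumS.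
by apply: measurable_funD; [exact: (IH (ltnW kn))|exact: mX].
Qed.

(** As [psum n] and [X n] are independent, their joint law is the product of their laws, by
    uniqueness of the product measure on rectangles. Tonelli's theorem then integrates [X n] with
    [psum n] frozen. *)
Lemma ge0_integral_psum_next n (phi : R * R -> \bar R) :
  measurable_fun setT phi -> (forall z, (0 <= phi z)%E) ->
  (\int[P]_w phi (psum n w, X n w) =
   \int[P]_w \int[distribution P (X n)]_x phi (psum n w, x))%E.
Proof.
move=> mphi phi0.
pose h w := (psum n w, X n w).
have mh : measurable_fun setT h by exact: measurable_fun_pair.
pose m1 := distribution P (psum n); pose m2 := distribution P (X n).
transitivity (\int[pushforward P h]_z phi z)%E.
  by rewrite ge0_integral_pushforward.
transitivity (\int[m1 \x m2]_z phi z)%E.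
  apply: (eq_measure_integral (m1 \x m2)%E) => A mA _.
  apply/esym; apply: product_measure_unique => // B C mB mC.
  rewrite [LHS](_ : _ = P (psum n @^-1` B `&` X n @^-1` C))//.
  apply: (independent_g_sigma_algebra (@cylinder_setI n)) => //.
  - exact: measurable_X.
  - by move=> A' ; exact: cylinder_independent.
  - exact: psum_preimage.
rewrite fubini_tonelli1// ge0_integral_distribution//.
- exact: measurable_fun_fubini_tonelli_F.
- by move=> s; exact: integral_ge0.
Qed.

Hypothesis same : forall n (B : set R), measurable B ->
  P (X n @^-1` B) = P (X 0%N @^-1` B).

Let nu := distribution P (X 0%N).

Let integral_law n (f : R -> \bar R) :
  (\int[distribution P (X n)]_x f x = \int[nu]_x f x)%E.
Proof. by apply: eq_measure_integral => B mB _; exact: same. Qed.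

Lemma ge0_expectation_psum_next n (f : R -> \bar R) (B : set R) :
  measurable_fun setT f -> (forall z, (0 <= f z)%E) -> measurable B ->
  (\int[P]_w ((\1_B (psum n w))%:E * f (X n w)) =
   P (psum n @^-1` B) * \int[P]_w f (X 0%N w))%E.
Proof.
move=> mf f0 mB.
have I0 : (0 <= \int[nu]_x f x)%E by exact: integral_ge0.
rewrite (@ge0_integral_psum_next n (fun z => ((\1_B z.1)%:E * f z.2)%E)).
- transitivity (\int[P]_w ((\1_B (psum n w))%:E * \int[nu]_x f x))%E.
    apply: eq_integral => w _ /=; rewrite ge0_integralZl ?lee_fin//.
    by rewrite integral_law.
  rewrite ge0_integralZr//; last first.
    by apply/measurable_EFinP; exact: measurableT_comp.
  have -> : (\int[P]_w (\1_B (psum n w))%:E = P (psum n @^-1` B))%E.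
    have mpB : measurable (psum n @^-1` B).
      by rewrite -[X in measurable X]setTI; exact: measurable_psum.
    by rewrite (integral_indic P measurableT mpB) setIT.
  by rewrite /nu ge0_integral_distribution.
- apply: emeasurable_funM; last exact: measurableT_comp.
  by apply/measurable_EFinP; exact: measurableT_comp.
- by move=> z; rewrite mule_ge0 ?lee_fin.
Qed.

(** Integrating out the last variable replaces [f] by its average, hence an induction on [n] for all
    [f]. *)
Lemma avg_psum n f y : unit_fun f ->
  avg (law P (psum n)) f y = iter n (avg (law P (X 0%N))) f y.
Proof.
elim: n f => [|n IH] f uf.
  apply: EFin_inj; rewrite avgE// ge0_integral_law; last 2 first.
  - by apply/measurable_EFinP; case: (unit_fun_shift y uf).
  - by move=> z; rewrite lee_fin; case/andP: (uf.2 (y + z)).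
  transitivity (\int[P]_w (f y)%:E)%E.
    by apply: eq_integral => w _; rewrite /= psum0 addr0.
  by rewrite integral_cst//= probability_setT mule1.
rewrite iterSr -IH; last exact: unit_fun_avg.
apply: EFin_inj; rewrite !avgE//; last exact: unit_fun_avg.
have f0 z : (0 <= (f z)%:E)%E by rewrite lee_fin; case/andP: (uf.2 z).
have mf (z : R) : measurable_fun setT (fun x => (f (z + x))%:E).
  by apply/measurable_EFinP; case: (unit_fun_shift z uf).
rewrite !ge0_integral_law//; last 2 first.
- by apply/measurable_EFinP; case: (unit_fun_shift y (unit_fun_avg (law P (X 0%N)) uf)).
- by move=> z; rewrite lee_fin; case/andP: ((unit_fun_avg (law P (X 0%N)) uf).2 (y + z)).
have step := @ge0_integral_psum_next n (fun z => (f (y + z.1 + z.2))%:E).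
rewrite /= in step.
transitivity (\int[P]_w (f (y + psum n w + X n w))%:E)%E.
  by apply: eq_integral => w _; rewrite /= psumS addrA.
rewrite step; last 2 first.
- apply/measurable_EFinP; apply: (measurableT_comp uf.1).
  by apply: measurable_funD => //; exact: measurable_funD.
- by move=> z; exact: f0.
apply: eq_integral => w _; rewrite avgE//= integral_law.
by rewrite ge0_integral_law// ge0_integral_distribution.
Qed.

End independent_sums.

Section central_limit.
Context d (Omega : measurableType d) (R : realType) (P : probability Omega R).
Variable X : nat -> {RV P >-> R}.
Hypothesis indX : mutually_independent X.
Hypothesis same : forall n (B : set R), measurable B ->
  P (X n @^-1` B) = P (X 0%N @^-1` B).

Lemma central_limit :
  (\int[P]_w (X 0%N w)%:E = 0)%E -> (\int[P]_w (X 0%N w ^+ 2)%:E = 1)%E ->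
  (\int[P]_w (`|X 0%N w| ^+ 3)%:E < +oo)%E ->
  forall e : R, 0 < e -> exists n0 : nat, forall n, (n0 <= n)%N -> forall y,
  `|fine (P [set w | psum X n w <= Num.sqrt n%:R * y]) -
    fine (normal_prob 0 1 `]-oo, y]%classic)| <= e.
Proof.
move=> X1 X2 X3 e e0.
have mn k : measurable_fun setT (fun x : R => (`|x| ^+ k)%:E).
  by apply/measurable_EFinP/measurable_funX; exact: normr_measurable.
have L3 : (\int[law P (X 0%N)]_x (`|x| ^+ 3)%:E < +oo)%E.
  by rewrite ge0_integral_law// => x; rewrite lee_fin.
have L2 : (\int[law P (X 0%N)]_x (x ^+ 2)%:E = 1)%E.
  rewrite ge0_integral_law// => [|x]; last by rewrite lee_fin sqr_ge0.
  by apply/measurable_EFinP; exact: measurable_funX.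
have mE : measurable_fun setT (EFin : R -> \bar R) by exact/measurable_EFinP.
have iX : P.-integrable setT (EFin \o X 0%N).
  apply/integrableP; split; first exact/measurable_EFinP.
  have /integrableP[_] := integrable_pow_le3 L3 (isT : 1 <= 3)%N.
  by rewrite (ge0_integral_law (X 0%N))//; exact: measurableT_comp.
have L1 : (\int[law P (X 0%N)]_x x%:E = 0)%E.
  by rewrite -X1 (integral_law_integrable mE iX).
have g1 : gauss 1 = normal_prob (0 : R) 1 :> probability (measurableTypeR R) R.
  by rewrite /gauss sqrtr1.
have gscale (v y : R) : 0 < v ->
    gauss v `]-oo, (Num.sqrt v * y)%R]%classic = gauss 1 `]-oo, y]%classic.
  by move=> v0; rewrite g1; apply: normal_prob_scale; rewrite sqrtr_gt0.
have gle (y h : R) : 0 <= h ->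
    (gauss 1%R `]-oo, (y + h)%R]%classic <= gauss 1%R `]-oo, y]%classic + h%:E)%E.
  by rewrite g1; exact: normal_prob_le.
have gm1 : (\int[gauss 1%R]_x x%:E = 0 :> \bar R)%E by rewrite g1 normal_prob_mean0.
have gm2 : (\int[gauss 1%R]_x (x ^+ 2)%:E = 1 :> \bar R)%E.
  by rewrite g1 normal_prob_moment2.
have gm3 : (\int[gauss 1%R]_x (`|x| ^+ 3)%:E < +oo :> \bar R)%E.
  by rewrite g1 normal_prob_moment3.
have [n0 n0P] := clt_cdf (@avg_gauss R) gscale gle gm1 gm2 gm3 L1 L2 L3
  (fun n f => avg_psum indX same n 0) e0.
by exists n0 => n nn0 y; have := n0P n nn0 y; rewrite g1.
Qed.

End central_limit.

(** * Gamma distribution *)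

Section gamma.
Context {R : realType}.
Local Notation mu := (@lebesgue_measure R).
Variables (k theta : R).

Lemma gamma_pdf_ge0 x : 0 <= gamma_pdf k theta x.
Proof.
rewrite /gamma_pdf; case: ifP => // x0.
rewrite divr_ge0// ?mulr_ge0 ?powR_ge0 ?expR_ge0//.
by apply: Rintegral_ge0 => t _; rewrite mulr_ge0 ?powR_ge0 ?expR_ge0.
Qed.

Lemma measurable_gamma_pdf : measurable_fun setT (gamma_pdf k theta).
Proof.
apply: measurable_fun_ifT => //; first exact: measurable_fun_ltr.
apply: measurable_funM => //; apply: measurable_funM; first exact: measurable_powR.
apply: measurableT_comp => //; apply: measurable_funN.
exact: measurable_funM.
Qed.

(** Exponential tilting of a gamma density gives, up to a constant, the same density rescaled. The
    Laplace transform thus reduces to the total mass, by a linear change of variable. *)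
Lemma gamma_pdf_scale (s x : R) : 0 < theta -> 0 <= s ->
  expR (- s * x) * gamma_pdf k theta x =
  (1 + theta * s) `^ (1 - k) * gamma_pdf k theta ((1 + theta * s) * x).
Proof.
move=> theta0 s0; have c0 : 0 < 1 + theta * s by rewrite ltr_pwDl// mulr_ge0// ltW.
rewrite /gamma_pdf pmulr_rgt0//; case: ifP => [x0|_]; last by rewrite !mulr0.
rewrite powRM ?ltW//.
have -> : (1 + theta * s) `^ (1 - k) = ((1 + theta * s) `^ (k - 1))^-1.
  by rewrite -powRN opprB.
have -> : - ((1 + theta * s) * x / theta) = - s * x - x / theta.
  by field; rewrite gt_eqF.
rewrite expRD; set g := (gamma_fun k * theta `^ k)^-1; field.
by rewrite gt_eqF// powR_gt0.
Qed.

Variable m : probability (measurableTypeR R) R.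
Hypothesis mE : forall B : set R, measurable B -> m B = gamma_prob k theta B.

Let ge0_integral_gamma (f : R -> \bar R) : measurable_fun setT f ->
  (forall x, (0 <= f x)%E) ->
  (\int[m]_x f x = \int[mu]_x (f x * (gamma_pdf k theta x)%:E))%E.
Proof.
move=> mf f0; apply: ge0_integral_density => //.
exact: measurable_gamma_pdf.
Qed.

Lemma eq_integral_gamma (f g : R -> \bar R) : measurable_fun setT f ->
  measurable_fun setT g -> (forall x, (0 <= f x)%E) -> (forall x, (0 <= g x)%E) ->
  (forall x, 0 < x -> f x = g x) -> (\int[m]_x f x = \int[m]_x g x)%E.
Proof.
move=> mf mg f0 g0 fg; rewrite !ge0_integral_gamma//; apply: eq_integral => x _.
by rewrite /gamma_pdf; case: ifP => [/fg ->//|_]; rewrite !mule0.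
Qed.

Lemma gamma_laplace (s : R) : 0 < theta -> 0 <= s ->
  (\int[m]_x (expR (- s * x))%:E = ((1 + theta * s) `^ (- k))%:E)%E.
Proof.
move=> theta0 s0; have c0 : 0 < 1 + theta * s by rewrite ltr_pwDl// mulr_ge0// ltW.
rewrite ge0_integral_gamma//; last first.
  by apply/measurable_EFinP/measurableT_comp => //; exact: measurable_funM.
under eq_integral do rewrite -EFinM gamma_pdf_scale// EFinM.
have mp : measurable_fun setT (EFin \o gamma_pdf k theta).
  by apply/measurable_EFinP; exact: measurable_gamma_pdf.
have p0 x : (0 <= (EFin \o gamma_pdf k theta) x)%E by rewrite lee_fin gamma_pdf_ge0.
rewrite ge0_integralZl_EFin ?powR_ge0//; last 2 first.
- by move=> x _; exact: p0.
- by apply: (measurableT_comp mp); exact: measurable_funM.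
have aff := ge0_integral_affine 0 (lt0r_neq0 c0) mp p0.
have -> : (\int[mu]_x (gamma_pdf k theta ((1 + theta * s) * x))%:E =
    (`|1 + theta * s|^-1)%:E * \int[mu]_x (EFin \o gamma_pdf k theta) x)%E.
  by rewrite -aff; apply: eq_integral => x _; rewrite addr0.
rewrite gtr0_norm//.
(* No evaluation of [gamma_fun] is required: the density has mass 1 because the probability [m] has
   it as density. *)
have -> : (\int[mu]_x (EFin \o gamma_pdf k theta) x = 1)%E.
  by rewrite -(probability_setT m) mE.
rewrite mule1 -EFinM; congr EFin.
rewrite [in RHS](_ : - k = (1 - k) + -1); last by ring.
rewrite [RHS]powRD; last by rewrite (gt_eqF c0) implybT.
by rewrite powR_inv1 ?ltW.
Qed.

End gamma.

(** * Hitting index of a random walk *)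

Section hitting_index.
Context {R : realType}.
Variables (S : nat -> R) (T : R).
Hypothesis ndS : {homo S : m n / (m <= n)%N >-> m <= n}.
Hypothesis S0 : S 0%N < T.

Definition hitting_index : \bar R :=
  ereal_inf [set n%:R%:E | n in [set n : nat | (1 <= n)%N /\ T <= S n]].

(** By monotonicity the indices with [S k < T] form an initial segment of the integers. It contains
    0, so the first index outside it is at least 1 and attains the infimum; if it is everything, the
    infimum is that of the empty set. *)
Lemma hitting_indexP :
  (exists2 m, hitting_index = m%:R%:E & forall k, (S k < T) = (k < m)%N) \/
  (hitting_index = +oo%E /\ forall k, S k < T).
Proof.
have [[n0 Tn0]|nT] := pselect (exists n, T <= S n); last first.
  right; have ST k : S k < T by rewrite ltNge; apply/negP => Tk; apply: nT; exists k.
  split => //; rewrite /hitting_index -ereal_inf0; congr ereal_inf.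
  apply/seteqP; split => [x [n [_ Tn] _]|//].
  by move: (ST n); rewrite ltNge Tn.
left; have exT : exists n, T <= S n by exists n0.
pose m := ex_minn exT.
have [Tm mmin] : T <= S m /\ forall k, T <= S k -> (m <= k)%N.
  by rewrite /m; case: ex_minnP.
have Sm k : (S k < T) = (k < m)%N.
  rewrite ltNge [RHS]ltnNge; congr negb; apply/idP/idP; first exact: mmin.
  by move=> /ndS; exact: le_trans.
exists m => //; apply/eqP; rewrite eq_le; apply/andP; split.
  apply: ereal_inf_lbound; exists m => //; split => //.
  by rewrite -Sm.
apply: le_ereal_inf_tmp => _ [n [_ Tn] <-].
by rewrite lee_fin ler_nat mmin.
Qed.

(** Pathwise form of E N = sum over k of P (N > k), valid also when the index is infinite. *)
Lemma hitting_indexE :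
  hitting_index = (\sum_(0 <= k <oo) ((S k < T)%R%:R)%:E)%E.
Proof.
have [[m -> Sm]|[-> ST]] := hitting_indexP.
  rewrite (nneseries_split 0 m)// add0n eseries0 ?adde0 => [|k mk _]; last first.
    by rewrite Sm ltnNge mk.
  rewrite -[m in LHS]subn0 -sumr_const_nat sumEFin; congr EFin.
  by apply: eq_big_nat => k /andP[_ km]; rewrite Sm km.
apply/esym/eqyP => A A0; pose n := (Num.truncn A).+1.
rewrite (le_trans _ (@nneseries_lim_ge _ _ xpredT 0 n _))//.
rewrite sumEFin lee_fin (eq_bigr (fun=> 1)) => [|k _]; last by rewrite ST.
by rewrite sumr_const_nat subn0 ltW// truncnS_gt.
Qed.

Lemma hitting_index_le (r : R) : 0 <= r ->
  (hitting_index <= r%:E)%E = (T <= S (Num.truncn r)).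
Proof.
move=> r0; have [[m -> Sm]|[-> ST]] := hitting_indexP; last first.
  by rewrite leye_eq [RHS]leNgt ST.
by rewrite [RHS]leNgt Sm -leqNgt lee_fin truncn_ge_nat.
Qed.

End hitting_index.

(** * Wald's identity and bounds on the renewal series *)

Section wald.
Context d (Omega : measurableType d) (R : realType) (P : probability Omega R).
Variable V : nat -> {RV P >-> R}.
Hypothesis indV : mutually_independent V.
Hypothesis same : forall n (B : set R), measurable B ->
  P (V n @^-1` B) = P (V 0%N @^-1` B).
Hypothesis V0 : forall n w, 0 <= V n w.
Variables (b t mean : R).
Hypothesis b0 : 0 <= b.
Hypothesis t0 : 0 < t.
Hypothesis mean_gt0 : 0 < mean.
Hypothesis EV : (\int[P]_w (V 0%N w)%:E = mean%:E)%E.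
(* In other words, V 0 <= b almost surely. *)
Hypothesis EVb : (\int[P]_w (Num.min (V 0%N w) b)%:E = mean%:E)%E.

Let I k w : R := \1_(`]-oo, t[%classic) (psum V k w).

Let IE k w : I k w = (psum V k w < t)%R%:R.
Proof. by rewrite /I indicE mem_setE in_itv/=. Qed.

Let psum_ge0 k w : 0 <= psum V k w.
Proof. by apply: sumr_ge0 => i _; exact: V0. Qed.

(** Terms are added only while [psum] is below [t], so the last one overshoots [t] by at most [b].
    The induction carries both bounds of the minimum: the one by [psum] yields the one by [t + b] at
    the next step. *)
Let sum_min_le K w :
  \sum_(k < K) I k w * Num.min (V k w) b <= Num.min (psum V K w) (t + b).
Proof.
elim: K => [|K IH]; first by rewrite big_ord0 le_min psum_ge0 addr_ge0// ltW.
rewrite big_ord_recr/= IE psumS; have := V0 K w; have := b0; move: IH.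
rewrite !le_min => /andP[h1 h2] b0' v0.
have [St|St] := ltP (psum V K w) t; last by rewrite mul0r addr0 h2 andbT; lra.
have m1 : Num.min (V K w) b <= V K w by rewrite ge_min lexx.
have m2 : Num.min (V K w) b <= b by rewrite ge_min lexx orbT.
by rewrite mul1r; apply/andP; split; lra.
Qed.

(** The sum follows [psum] until [t] is crossed, and then keeps a value of at least [t]. *)
Let min_le_sum K w :
  Num.min (psum V K w) t <= \sum_(k < K) I k w * V k w.
Proof.
elim: K => [|K IH]; first by rewrite big_ord0 ge_min psum0 lexx.
rewrite big_ord_recr/= IE psumS; have := V0 K w; move: IH => /=.
have [St|St] := ltP (psum V K w) t; last first.
  by rewrite mul0r addr0 => IH v0; rewrite (le_trans _ IH)// ge_min lexx orbT.
by rewrite mul1r => IH v0; rewrite ge_min lerD2r IH.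
Qed.

Let p k := P [set w | psum V k w < t].

Let pE k : p k = P (psum V k @^-1` `]-oo, t[%classic).
Proof. by congr (P _); apply/seteqP; split => w /=; rewrite in_itv. Qed.

Let mI k : measurable_fun setT (I k).
Proof. by apply: measurableT_comp => //; exact: measurable_indic. Qed.

Let integral_I k : (\int[P]_w (I k w)%:E = p k)%E.
Proof.
have m : measurable (psum V k @^-1` `]-oo, t[%classic).
  by rewrite -[X in measurable X]setTI; exact: measurable_funP.
by rewrite pE -[in RHS](setIT (_ @^-1` _)) -(integral_indic P measurableT m).
Qed.

(** To be applied to [|x|] and [Num.min |x| b]: the absolute value makes them nonnegative on the
    whole line and is invisible on [V k]. *)
Let wald (f : R -> R) k : measurable_fun setT f -> (forall x, 0 <= f x) ->
  (\int[P]_w (f (V 0%N w))%:E = mean%:E)%E ->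
  (\int[P]_w (I k w * f (V k w))%:E = p k * mean%:E)%E.
Proof.
move=> mf f0 <-; rewrite pE.
rewrite -(ge0_expectation_psum_next indV same k (f := EFin \o f))//.
exact/measurable_EFinP.
Qed.

Lemma renewal_le K : (mean%:E * \sum_(0 <= k < K) p k <= (t + b)%:E)%E.
Proof.
pose f (x : R) := Num.min `|x| b.
have mf : measurable_fun setT f by apply: measurable_minr => //; exact: normr_measurable.
have f0 x : 0 <= f x by rewrite le_min normr_ge0.
have fV k w : f (V k w) = Num.min (V k w) b by rewrite /f ger0_norm.
have Ef : (\int[P]_w (f (V 0%N w))%:E = mean%:E)%E.
  by rewrite -EVb; apply: eq_integral => w _; rewrite fV.
rewrite muleC ge0_sume_distrl//.
rewrite (eq_bigr (fun k => \int[P]_w (I k w * f (V k w))%:E)%E); last first.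
  by move=> k _; rewrite wald.
rewrite big_mkord -ge0_integral_sum//; last 2 first.
- move=> k; apply/measurable_EFinP/measurable_funM => //.
  exact: measurableT_comp.
- by move=> k w _; rewrite lee_fin mulr_ge0// IE ler0n.
have -> : (t + b)%:E = (\int[P]_w (t + b)%:E)%E.
  by rewrite integral_cst//= probability_setT mule1.
have mIf k : measurable_fun setT (fun w => (I k w * f (V k w))%:E).
  by apply/measurable_EFinP/measurable_funM => //; exact: measurableT_comp.
apply: ge0_le_integral => //.
- by move=> w _; apply: sume_ge0 => k _; rewrite lee_fin mulr_ge0// IE ler0n.
- exact: emeasurable_sum.
- move=> w _; rewrite sumEFin lee_fin; under eq_bigr do rewrite fV.
  by rewrite (le_trans (sum_min_le K w))// ge_min lexx orbT.
Qed.

(** The term [t%:E * p K] pays for the paths that have not crossed [t] by index [K]. *)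
Lemma renewal_ge K :
  (t%:E <= mean%:E * \sum_(0 <= k < K) p k + t%:E * p K)%E.
Proof.
have mIV k : measurable_fun setT (fun w => (I k w * `|V k w|)%:E).
  apply/measurable_EFinP/measurable_funM => //.
  by apply: measurableT_comp => //; exact: normr_measurable.
have mtI : measurable_fun setT (fun w => (t * I K w)%:E).
  by apply/measurable_EFinP/measurable_funM.
have I0 k w : 0 <= I k w by rewrite IE ler0n.
have Ef : (\int[P]_w (`|V 0%N w|)%:E = mean%:E)%E.
  by rewrite -EV; apply: eq_integral => w _; rewrite ger0_norm.
rewrite muleC ge0_sume_distrl//.
rewrite (eq_bigr (fun k => \int[P]_w (I k w * `|V k w|)%:E)%E); last first.
  by move=> k _; rewrite (@wald (fun x => `|x|))//; exact: normr_measurable.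
have -> : (t%:E * p K = \int[P]_w (t * I K w)%:E)%E.
  rewrite -integral_I -ge0_integralZl_EFin// ?ltW//; first by move=> w _; rewrite lee_fin.
  exact/measurable_EFinP.
rewrite big_mkord -ge0_integral_sum//; last first.
  by move=> k w _; rewrite lee_fin mulr_ge0.
rewrite -ge0_integralD//; last 3 first.
- by move=> w _; apply: sume_ge0 => k _; rewrite lee_fin mulr_ge0.
- exact: emeasurable_sum.
- by move=> w _; rewrite lee_fin mulr_ge0// ltW.
have -> : t%:E = (\int[P]_w t%:E)%E.
  by rewrite integral_cst//= probability_setT mule1.
apply: ge0_le_integral => //.
- by move=> w _; rewrite lee_fin ltW.
- by apply: emeasurable_funD => //; exact: emeasurable_sum.
- move=> w _; rewrite sumEFin -EFinD lee_fin.
  under eq_bigr do rewrite ger0_norm//.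
  have := min_le_sum K w; rewrite IE.
  case: ltP => [_ _|_ ts]; last by rewrite mulr0 addr0.
  by rewrite mulr1 lerDr sumr_ge0// => k _; rewrite mulr_ge0.
Qed.

Lemma renewal_series :
  (t%:E <= mean%:E * \sum_(0 <= k <oo) p k <= (t + b)%:E)%E.
Proof.
have p0 k : (0 <= p k)%E by [].
have pf k : p k \is a fin_num.
  by rewrite pE fin_num_measure// -[X in measurable X]setTI; exact: measurable_funP.
apply/andP; split; last first.
  rewrite muleC -lee_pdivlMr//; apply: lime_le; first exact: is_cvg_nneseries.
  by apply: nearW => n; rewrite lee_pdivlMr// muleC renewal_le.
apply/lee_addgt0Pr => e e0.
(* Otherwise every [p k] would be at least [e / t], and the partial sums would exceed the uniform
   bound of [renewal_le]. *)
have [K pK] : exists K, (t%:E * p K <= e%:E)%E.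
  apply: contrapT => /forallNP h.
  have pE' k : p k = (fine (p k))%:E by rewrite fineK.
  have pe k : e / t <= fine (p k).
    have /negP := h k; rewrite -ltNge pE' -EFinM lte_fin => /ltW.
    by rewrite ler_pdivrMr// mulrC.
  pose n := (Num.truncn ((t + b) / (mean * (e / t)))).+1.
  have := renewal_le n; under eq_bigr do rewrite pE'.
  rewrite sumEFin -EFinM lee_fin leNgt => /negP; apply.
  have met : 0 < mean * (e / t) by rewrite mulr_gt0// divr_gt0.
  have : (t + b) / (mean * (e / t)) < n%:R by exact: truncnS_gt.
  rewrite ltr_pdivrMr// => /lt_le_trans; apply.
  rewrite mulrCA ler_pM2l// mulr_natl -[n in leLHS]subn0 -sumr_const_nat.
  by apply: ler_sum => k _.
apply: (le_trans (renewal_ge K)); apply: leeD => //.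
apply: lee_wpmul2l; first by rewrite lee_fin ltW.
exact: nneseries_lim_ge.
Qed.

End wald.

Section composition.
Context d (Omega : measurableType d) (R : realType) (P : probability Omega R).
Variables (g : R -> R) (mg : measurable_fun setT g).

(* The proof of measurability is an argument so that the composite is canonically
   a random variable. *)
Definition rv_comp of measurable_fun setT g := fun (X : {RV P >-> R}) (w : Omega) =>
  g (X w).

Let measurable_rv_comp X : measurable_fun setT (rv_comp mg X).
Proof. exact: measurableT_comp. Qed.

HB.instance Definition _ X := isMeasurableFun.Build _ _ _ _ (rv_comp mg X)
  (measurable_rv_comp X).

Lemma mutually_independent_comp (X : nat -> {RV P >-> R}) :
  mutually_independent X -> mutually_independent (P := P) (fun n => rv_comp mg (X n)).
Proof.
move=> iX s B us mB; apply: (iX s (fun i => g @^-1` B i) us) => i.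
by rewrite -[X in measurable X]setTI; exact: mg.
Qed.

Lemma identically_distributed_comp (X : nat -> {RV P >-> R}) :
  (forall n (B : set R), measurable B -> P (X n @^-1` B) = P (X 0%N @^-1` B)) ->
  forall n (B : set R), measurable B ->
    P (rv_comp mg (X n) @^-1` B) = P (rv_comp mg (X 0%N) @^-1` B).
Proof.
move=> same n B mB; apply: (same n (g @^-1` B)).
by rewrite -[X in measurable X]setTI; exact: mg.
Qed.

End composition.

Section standardization.
Context d (Omega : measurableType d) (R : realType) (P : probability Omega R).
Variables (V : {RV P >-> R}) (mean sd : R).
Hypothesis V0 : forall w, 0 <= V w.
Hypothesis sd0 : 0 < sd.
Hypothesis EV1 : (\int[P]_w (V w)%:E = mean%:E)%E.
Hypothesis EV2 : (\int[P]_w (V w ^+ 2)%:E = (mean ^+ 2 + sd ^+ 2)%:E)%E.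
Hypothesis EV3 : (\int[P]_w (V w ^+ 3)%:E < +oo)%E.

Let mean0 : 0 <= mean.
Proof. by rewrite -lee_fin -EV1 integral_ge0// => w _; rewrite lee_fin. Qed.

Let mV n : measurable_fun setT (fun w => (V w ^+ n)%:E).
Proof. by apply/measurable_EFinP; exact: measurable_funX. Qed.

Let integrable_pow n : (\int[P]_w (V w ^+ n)%:E < +oo)%E ->
  P.-integrable setT (EFin \o (fun w => V w ^+ n)).
Proof.
move=> Vn; apply/integrableP; split; first exact: mV.
by under eq_integral do rewrite /= ger0_norm ?exprn_ge0//.
Qed.

Let i1 : P.-integrable setT (EFin \o V).
Proof. by apply: (@integrable_pow 1); rewrite EV1 ltry. Qed.

Let i2 : P.-integrable setT (EFin \o (fun w => V w ^+ 2)).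
Proof. by apply: integrable_pow; rewrite EV2 ltry. Qed.

(** The sign is reversed so that the event [t <= psum V n] becomes an upper bound on the
    standardized sum, hence a value of its distribution function. *)
Lemma standardized_mean : (\int[P]_w ((mean - V w) / sd)%:E = 0)%E.
Proof.
transitivity (\int[P]_w ((sd^-1)%:E * (mean%:E - (V w)%:E)))%E.
  by apply: eq_integral => w _; rewrite -EFinB -EFinM mulrC.
have ic := finite_measure_integrable_cst P mean measurableT.
rewrite integralZl//; last exact: (integrableB measurableT ic i1).
rewrite (integralB measurableT ic i1)//= EV1 integral_cst//= probability_setT mule1.
by rewrite -EFinB subrr mule0.
Qed.

Lemma standardized_moment2 : (\int[P]_w (((mean - V w) / sd) ^+ 2)%:E = 1)%E.
Proof.
have ic := finite_measure_integrable_cst P (mean ^+ 2) measurableT.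
have iV := integrableZl measurableT (2 * mean) i1.
transitivity (\int[P]_w ((sd ^- 2)%:E *
    ((V w ^+ 2)%:E + (mean ^+ 2)%:E - (2 * mean)%:E * (V w)%:E)))%E.
  apply: eq_integral => w _.
  rewrite -[RHS]/((sd ^- 2 * (V w ^+ 2 + mean ^+ 2 - 2 * mean * V w))%:E).
  by congr EFin; field; rewrite gt_eqF.
have iD := integrableD measurableT i2 ic.
rewrite integralZl//; last exact: (integrableB measurableT iD iV).
rewrite (integralB measurableT iD iV)//= (integralD measurableT i2 ic)//=.
rewrite EV2 integral_cst//= probability_setT mule1 (integralZl measurableT i1) EV1.
rewrite -[LHS]/((sd ^- 2 * (mean ^+ 2 + sd ^+ 2 + mean ^+ 2 - 2 * mean * mean))%:E).
by congr EFin; field; rewrite gt_eqF.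
Qed.

(** For nonnegative numbers the distance [|mean - v|] is at most the larger of the two. *)
Lemma standardized_moment3 : (\int[P]_w (`|(mean - V w) / sd| ^+ 3)%:E < +oo)%E.
Proof.
have k0 : 0 <= sd ^- 3 by rewrite invr_ge0 exprn_ge0// ltW.
apply: (@le_lt_trans _ _ (\int[P]_w ((sd ^- 3)%:E * ((mean ^+ 3)%:E + (V w ^+ 3)%:E)))%E).
  apply: ge0_le_integral => //.
  - apply/measurable_EFinP/measurable_funX; apply: measurableT_comp => //.
    by apply: measurable_funM => //; exact: measurable_funB.
  - by apply: emeasurable_funM => //; exact: emeasurable_funD.
  - move=> w _; rewrite -EFinD -EFinM lee_fin normrM exprMn normfV (gtr0_norm sd0).
    rewrite exprVn mulrC ler_wpM2l//.
    have := V0 w; move: (V w) => v v0.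
    have [mv|mv] := leP v mean.
      rewrite ger0_norm ?subr_ge0// (@le_trans _ _ (mean ^+ 3))//.
        by rewrite lerXn2r ?nnegrE ?subr_ge0// lerBlDr lerDl.
      by rewrite lerDl exprn_ge0.
    rewrite ltr0_norm ?subr_lt0// opprB (@le_trans _ _ (v ^+ 3))//.
      by have m0 := mean0; apply: lerXn2r; rewrite ?nnegrE; lra.
    by rewrite lerDr exprn_ge0.
rewrite ge0_integralZl_EFin//; last 2 first.
- by move=> w _; rewrite adde_ge0// lee_fin exprn_ge0.
- exact: emeasurable_funD.
rewrite lte_mul_pinfty// ge0_integralD//; last 2 first.
- by move=> w _; rewrite lee_fin exprn_ge0.
- by move=> w _; rewrite lee_fin exprn_ge0.
by rewrite lte_add_pinfty// integral_cst//= probability_setT mule1 ltry.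
Qed.

End standardization.

Lemma expectation_hitting_index d (Omega : measurableType d) (R : realType)
    (P : probability Omega R) (V : nat -> {RV P >-> R}) (t : R) :
  (forall n w, 0 <= V n w) -> 0 < t ->
  (\int[P]_w hitting_index (fun n => psum V n w) t =
   \sum_(0 <= k <oo) P [set w | (psum V k w < t)%R])%E.
Proof.
move=> V0 t0.
have nd w : {homo (fun n => psum V n w) : m n / (m <= n)%N >-> m <= n}.
  apply: homo_leq => //; first exact: le_trans.
  by move=> n; rewrite psumS lerDl.
have m k : measurable [set w | psum V k w < t].
  rewrite (_ : [set w | _] = psum V k @^-1` `]-oo, t[%classic).
    by rewrite -[X in measurable X]setTI; exact: measurable_funP.
  by apply/seteqP; split => w /=; rewrite in_itv.
transitivity (\int[P]_w \sum_(0 <= k <oo) (\1_[set w | (psum V k w < t)%R] w)%:E)%E.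
  apply: eq_integral => w _; rewrite hitting_indexE ?psum0//.
  apply: eq_eseriesr => k _; rewrite indicE.
  by congr ((nat_of_bool _)%:R%:E); apply/idP/idP; rewrite inE.
rewrite integral_nneseries//; last by move=> k; exact/measurable_EFinP.
by apply: eq_eseriesr => k _; rewrite (integral_indic P measurableT (m k)) setIT.
Qed.

(** * Limit theorems for the hitting index *)

Section renewal_limits.
Context d (Omega : measurableType d) (R : realType) (P : probability Omega R).
Variable V : nat -> {RV P >-> R}.
Hypothesis indV : mutually_independent V.
Hypothesis same : forall n (B : set R), measurable B ->
  P (V n @^-1` B) = P (V 0%N @^-1` B).
Hypothesis V0 : forall n w, 0 <= V n w.
Variable mean : R.
Hypothesis mean_gt0 : 0 < mean.
Hypothesis EV : (\int[P]_w (V 0%N w)%:E = mean%:E)%E.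

Local Notation N t w := (hitting_index (fun n => psum V n w) t).

(** Multiplied by eps^2 / mean, the bounds of [renewal_series] at level T / eps^2 differ by the
    overshoot term b * eps^2 / mean, which vanishes in the limit. *)
Lemma renewal_expectation (b T : R) : 0 <= b -> 0 < T ->
  (\int[P]_w (Num.min (V 0%N w) b)%:E = mean%:E)%E ->
  ((eps ^+ 2)%:E * \int[P]_w N (T / eps ^+ 2) w)%E @[eps --> (0 : R)^'+]
    --> (T / mean)%:E.
Proof.
move=> b0 T0 EVb.
apply: (@squeeze_cvge _ _ _ _ (cst (T / mean)%:E) _
  (fun eps => ((T + b * eps ^+ 2) / mean)%:E)).
- near=> eps.
  have e0 : 0 < eps by near: eps; exact: nbhs_right_gt.
  have e2 : 0 < eps ^+ 2 by rewrite exprn_gt0.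
  have t0 : 0 < T / eps ^+ 2 by rewrite divr_gt0.
  rewrite expectation_hitting_index//.
  have /andP[h1 h2] := renewal_series indV same V0 b0 t0 mean_gt0 EV EVb.
  set S := (\sum_(0 <= k <oo) _)%E in h1 h2 *.
  case: S h1 h2 => [s| |]; last 2 first.
  - by rewrite gt0_muley// leye_eq.
  - by rewrite gt0_muleNy// leeNy_eq.
  rewrite -EFinM !lee_fin ler_pdivrMr// => h1 h2; apply/andP; split.
    by rewrite ler_pdivrMr//; lra.
  rewrite ler_pdivlMr//.
  have -> : T + b * eps ^+ 2 = (T / eps ^+ 2 + b) * eps ^+ 2.
    by rewrite mulrDl divfK// gt_eqF.
  by rewrite -mulrA mulrC ler_pM2r// mulrC.
- exact: cvg_cst.
- apply: cvg_EFin; first exact: nearW.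
  rewrite [X in _ --> X](_ : _ = (T + b * 0 ^+ 2) / mean); last first.
    by rewrite expr0n mulr0 addr0.
  apply: cvg_at_right_filter; apply: cvgM; last exact: cvg_cst.
  apply: cvgD; first exact: cvg_cst.
  by apply: cvgM; [exact: cvg_cst|exact: exprn_continuous].
Unshelve. all: by end_near. Qed.

Variable sd : R.
Hypothesis sd_gt0 : 0 < sd.
Hypothesis EV2 : (\int[P]_w (V 0%N w ^+ 2)%:E = (mean ^+ 2 + sd ^+ 2)%:E)%E.
Hypothesis EV3 : (\int[P]_w (V 0%N w ^+ 3)%:E < +oo)%E.

Let measurable_std : measurable_fun setT (fun v : R => (mean - v) / sd).
Proof. by apply: measurable_funM => //; exact: measurable_funB. Qed.

Let X n : {RV P >-> R} := rv_comp measurable_std (V n).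

Let psumX n w : psum X n w = (n%:R * mean - psum V n w) / sd.
Proof.
elim: n => [|n IH]; first by rewrite !psum0 mul0r subrr mul0r.
rewrite psumS psumS IH -natr1.
have -> : X n w = (mean - V n w) / sd by [].
by field; exact: lt0r_neq0.
Qed.

(* For [n >= 1], [N t <= n] iff the standardized sum of n terms is at most
   [(n * mean - t) / (sd * sqrt n)]. *)
Let renewal_clt_nat (e : R) : 0 < e -> exists n0 : nat, forall n t, (n0 <= n)%N ->
  `|fine (P [set w | t <= psum V n w]) -
    fine (normal_prob 0 1 `]-oo, (n%:R * mean - t) / (sd * Num.sqrt n%:R)]%classic)| <= e.
Proof.
move=> e0.
have [n0 n0P] := @central_limit _ _ _ P X (mutually_independent_comp measurable_std indV)
  (identically_distributed_comp measurable_std same)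
  (standardized_mean sd (V0 0%N) EV) (standardized_moment2 (V0 0%N) sd_gt0 EV EV2)
  (standardized_moment3 (V0 0%N) sd_gt0 EV EV3) e e0.
(* The successor excludes n = 0, where dividing by [sd * Num.sqrt 0] would give 0 by convention. *)
exists n0.+1 => -[//|n] t nn0.
have := n0P n.+1 (ltnW nn0) ((n.+1%:R * mean - t) / (sd * Num.sqrt n.+1%:R)).
rewrite (_ : [set w | _] = [set w | t <= psum V n.+1 w])//.
have s0 : Num.sqrt n.+1%:R != 0 :> R by rewrite gt_eqF// sqrtr_gt0 ltr0n.
have -> : Num.sqrt n.+1%:R * ((n.+1%:R * mean - t) / (sd * Num.sqrt n.+1%:R)) =
    (n.+1%:R * mean - t) / sd by field; rewrite s0 gt_eqF.
apply/seteqP; split => w /=.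
  by rewrite psumX ler_pM2r ?invr_gt0// lerD2l lerN2.
by rewrite psumX ler_pM2r ?invr_gt0// lerD2l lerN2.
Qed.

Let normal_cdf_dist (y u : R) :
  `|fine (normal_prob 0 1 `]-oo, u]%classic) - fine (normal_prob 0 1 `]-oo, y]%classic)| <=
  `|u - y|.
Proof.
wlog yu : y u / y <= u.
  by move=> h; have [/h//|/ltW/h] := leP y u; rewrite distrC [leRHS]distrC.
have fN z : normal_prob (0 : R) 1 `]-oo, z]%classic \is a fin_num by exact: fin_num_measure.
have mono : fine (normal_prob 0 1 `]-oo, y]%classic) <= fine (normal_prob 0 1 `]-oo, u]%classic).
  apply: fine_le => //; apply: le_measure; rewrite ?inE//.
  by apply: subset_itvl; rewrite bnd_simp.
rewrite !ger0_norm ?subr_ge0// lerBlDl.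
have := @normal_prob_le R y (u - y); rewrite subr_ge0 => /(_ yu).
rewrite (_ : y + (u - y) = u); last by rewrite addrC subrK.
by move=> h; rewrite -lee_fin EFinD (fineK (fN u)) (fineK (fN y)).
Qed.

Section fluctuations.
Variables (T u : R).
Hypothesis T0 : 0 < T.

(** [tau] is the limit of eps^2 * N and [eps * q] the scale of its fluctuations. The normalized
    index is at most [u] exactly when N is at most [r eps], and [theta] is the error of rounding [r]
    down. *)
Let tau := T / mean.
Let q := sd * Num.sqrt tau / mean.
Let r eps := (u * eps * q + tau) / eps ^+ 2.
Let n eps := Num.truncn (r eps).
Let theta eps := r eps - (n eps)%:R.

Let tau0 : 0 < tau. Proof. by rewrite divr_gt0. Qed.
Let q0 : 0 < q. Proof. by rewrite divr_gt0// mulr_gt0// sqrtr_gt0. Qed.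

Let renewal_event eps : 0 < eps -> 0 <= r eps ->
  [set w | (((eps * q)^-1)%:E * ((eps ^+ 2)%:E * N (T / eps ^+ 2) w - tau%:E) <= u%:E)%E] =
  [set w | T / eps ^+ 2 <= psum V (n eps) w].
Proof.
move=> e0 r0; have e2 : 0 < eps ^+ 2 by rewrite exprn_gt0.
have t0 : 0 < T / eps ^+ 2 by rewrite divr_gt0.
have nd w : {homo (fun n => psum V n w) : m n / (m <= n)%N >-> m <= n}.
  apply: homo_leq => //; first exact: le_trans.
  by move=> k; rewrite psumS lerDl.
have eq0 : 0 < eps * q by rewrite mulr_gt0.
suff eqv w : (((eps * q)^-1)%:E * ((eps ^+ 2)%:E * N (T / eps ^+ 2) w - tau%:E) <= u%:E)%E =
    (T / eps ^+ 2 <= psum V (n eps) w).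
  by apply/seteqP; split => w /=; rewrite eqv.
have S0 : (fun n => psum V n w) 0%N < T / eps ^+ 2 by rewrite psum0.
rewrite -(hitting_index_le (nd w) S0 r0).
have [[m Nm _]|[Noo _]] := hitting_indexP (nd w) S0; rewrite ?Nm ?Noo.
  have -> : (((eps * q)^-1)%:E * ((eps ^+ 2)%:E * m%:R%:E - tau%:E))%E =
      ((eps * q)^-1 * (eps ^+ 2 * m%:R - tau))%:E by [].
  rewrite !lee_fin mulrC ler_pdivrMr// lerBlDr /r ler_pdivlMr// mulrC.
  by rewrite -[u * eps * q]mulrA.
by rewrite gt0_muley ?lte_fin// addye// gt0_muley ?lte_fin ?invr_gt0// !leye_eq.
Qed.

(** Whatever the sign of [u], the numerator of [r] tends to [tau > 0] while its denominator tends to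
    0. *)
Let r_ge (M : R) : \forall eps \near (0 : R)^'+, M <= r eps.
Proof.
near=> eps.
have e0 : 0 < eps by near: eps; exact: nbhs_right_gt.
rewrite /r ler_pdivlMr ?exprn_gt0// -subr_ge0.
near: eps.
have : (u * eps * q + tau - M * eps ^+ 2) @[eps --> (0 : R)^'+] --> tau.
  rewrite [X in _ --> X](_ : tau = u * 0 * q + tau - M * 0 ^+ 2); last first.
    by rewrite expr0n !mulr0 mul0r add0r subr0.
  apply: cvg_at_right_filter; apply: cvgB.
    apply: cvgD; last exact: cvg_cst.
    apply: cvgM; last exact: cvg_cst.
    by apply: cvgM; [exact: cvg_cst|exact: cvg_id].
  by apply: cvgM; [exact: cvg_cst|exact: exprn_continuous].
by move=> /cvgr_ge; apply.
Unshelve. all: by end_near. Qed.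

Let theta_cvg : theta eps * eps @[eps --> (0 : R)^'+] --> (0 : R).
Proof.
apply: (@squeeze_cvgr _ _ _ _ (fun _ : R => 0 : R) (fun eps : R => eps)
  (fun eps : R => theta eps * eps)).
- near=> eps.
  have e0 : 0 < eps by near: eps; exact: nbhs_right_gt.
  have r0 : 0 <= r eps by near: eps; exact: r_ge.
  have /andP[h1 h2] := truncn_itv r0.
  have t0 : 0 <= theta eps by rewrite subr_ge0.
  have t1 : theta eps <= 1 by rewrite /theta lerBlDl natr1 ltW.
  by rewrite mulr_ge0 ?ler_piMl// ltW.
- exact: cvg_cst.
- by apply: cvg_at_right_filter; exact: cvg_id.
Unshelve. all: by end_near. Qed.

Let y eps := ((n eps)%:R * mean - T / eps ^+ 2) / (sd * Num.sqrt (n eps)%:R).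

(** With D = eps^2 * n, the numerator of [y] is mean * (u * q - theta * eps) / eps and sqrt n = sqrt
    D / eps, so the two factors 1 / eps cancel. The value of [q] is the one that makes the limit
    equal to [u]. *)
Let y_cvg : y eps @[eps --> (0 : R)^'+] --> u.
Proof.
pose D eps := u * eps * q + tau - theta eps * eps * eps.
have Dcvg : D eps @[eps --> (0 : R)^'+] --> tau.
  rewrite [X in _ --> X](_ : tau = u * 0 * q + tau - 0 * 0); last first.
    by rewrite !mulr0 mul0r add0r subr0.
  apply: cvgB.
    apply: cvg_at_right_filter; apply: cvgD; last exact: cvg_cst.
    apply: cvgM; last exact: cvg_cst.
    by apply: cvgM; [exact: cvg_cst|exact: cvg_id].
  by apply: cvgM; [exact: theta_cvg|exact: cvg_at_right_filter].
have st0 : Num.sqrt tau != 0 by rewrite gt_eqF// sqrtr_gt0.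
have m0 : mean != 0 by rewrite gt_eqF.
have s0 : sd != 0 by rewrite gt_eqF.
have : (mean * (u * q - theta eps * eps)) / (sd * Num.sqrt (D eps))
    @[eps --> (0 : R)^'+] --> u.
  rewrite [X in _ --> X](_ : u = (mean * (u * q - 0)) / (sd * Num.sqrt tau)); last first.
    by rewrite /q; field; rewrite st0 m0 s0.
  apply: cvgM.
    apply: cvgM; first exact: cvg_cst.
    by apply: cvgB; [exact: cvg_cst|exact: theta_cvg].
  apply: cvgV; first by rewrite mulf_neq0.
  apply: cvgM; first exact: cvg_cst.
  by apply: continuous_cvg => //; exact: sqrt_continuous.
apply: cvg_trans; apply: near_eq_cvg; near=> eps.
have e0 : 0 < eps by near: eps; exact: nbhs_right_gt.
have r0 : 1 <= r eps by near: eps; exact: r_ge.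
have n0 : (0 < n eps)%N by rewrite /n truncn_gt0.
have nE : (n eps)%:R = D eps / eps ^+ 2.
  by rewrite /D /theta /r; field; exact: lt0r_neq0.
have D0 : 0 < D eps.
  have : 0 < (n eps)%:R :> R by rewrite ltr0n.
  by rewrite nE pmulr_lgt0// invr_gt0 exprn_gt0.
have sD0 : Num.sqrt (D eps) != 0 by rewrite gt_eqF// sqrtr_gt0.
have sE : Num.sqrt (n eps)%:R = Num.sqrt (D eps) / eps.
  by rewrite nE sqrtrM ?ltW// sqrtrV ?sqr_ge0// sqrtr_sqr gtr0_norm.
have TE : T = tau * mean by rewrite /tau divfK.
rewrite /y sE nE TE; move: (Num.sqrt (D eps)) sD0 => S S0.
by rewrite /D; field; rewrite S0 s0 lt0r_neq0.
Unshelve. all: by end_near. Qed.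

Lemma renewal_clt :
  P [set w | (((eps * q)^-1)%:E * ((eps ^+ 2)%:E * N (T / eps ^+ 2) w - tau%:E) <= u%:E)%E]
    @[eps --> (0 : R)^'+] --> normal_prob 0 1 `]-oo, u]%classic.
Proof.
pose p eps := fine (P [set w | T / eps ^+ 2 <= psum V (n eps) w]).
have pcvg : p eps @[eps --> (0 : R)^'+] --> fine (normal_prob 0 1 `]-oo, u]%classic).
  apply/cvgrPdist_le => e e0.
  have e20 : 0 < e / 2 by rewrite divr_gt0.
  have [n0 n0P] := renewal_clt_nat e20.
  near=> eps.
  have n0n : (n0 <= n eps)%N.
    rewrite /n truncn_ge_nat; last by near: eps; exact: r_ge.
    by near: eps; exact: r_ge.
  (* The intermediate point is the normal distribution function at the moving threshold [y eps]:
     Lipschitz continuity compares it with the value at [u], the uniform central limit theorem with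
     [p eps]. *)
  apply: (le_trans (ler_distD (fine (normal_prob 0 1 `]-oo, y eps]%classic)) _ _)).
  rewrite (splitr e) lerD//.
    apply: (le_trans (normal_cdf_dist _ _)).
    by near: eps; move/cvgrPdist_le : y_cvg; exact.
  by rewrite distrC; exact: n0P.
have fN z : normal_prob (0 : R) 1 `]-oo, z]%classic \is a fin_num by exact: fin_num_measure.
rewrite -(fineK (fN u)).
have eventE : \forall eps \near (0 : R)^'+,
    [set w | (((eps * q)^-1)%:E * ((eps ^+ 2)%:E * N (T / eps ^+ 2) w - tau%:E) <= u%:E)%E] =
    [set w | T / eps ^+ 2 <= psum V (n eps) w].
  near=> eps; apply: renewal_event; first by near: eps; exact: nbhs_right_gt.
  by near: eps; exact: r_ge.
apply: cvg_EFin.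
  near=> eps; have -> := near eventE eps; last by [].
  apply: fin_num_measure.
  rewrite (_ : [set w | _] = psum V (n eps) @^-1` `[T / eps ^+ 2, +oo[%classic).
    by rewrite -[X in measurable X]setTI; exact: measurable_funP.
  by apply/seteqP; split => w /=; rewrite in_itv/= andbT.
apply: cvg_trans pcvg; apply: near_eq_cvg; near=> eps.
by rewrite /p /=; have -> := near eventE eps.
Unshelve. all: by end_near. Qed.

End fluctuations.
End renewal_limits.

(** * Brownian skeleton *)

Section gamma_skeleton.
Context d (Omega : measurableType d) (R : realType) (P : probability Omega R).
Variable A : nat -> {RV P >-> R}.
Hypothesis iidA : iid_gamma (3 / 2) 2 A.

Let measurable_step : measurable_fun setT (fun a : R => expR (1 - a)).
Proof. by apply: measurableT_comp => //; exact: measurable_funB. Qed.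

Definition gamma_step n : {RV P >-> R} := rv_comp measurable_step (A n).
Local Notation V := gamma_step.

Lemma gamma_step_ge0 n w : 0 <= V n w. Proof. exact: expR_ge0. Qed.

Lemma independent_gamma_step : mutually_independent V.
Proof. by apply: mutually_independent_comp; case: iidA. Qed.

Lemma identically_distributed_gamma_step n (B : set R) : measurable B ->
  P (V n @^-1` B) = P (V 0%N @^-1` B).
Proof.
apply: identically_distributed_comp => {}n {}B mB.
by case: iidA => _ dA; exact: etrans (dA n B mB) (esym (dA 0%N B mB)).
Qed.

Let lawA (B : set R) : measurable B -> law P (A 0%N) B = gamma_prob (3 / 2) 2 B.
Proof. by case: iidA => _ dA; exact: dA. Qed.

Lemma gamma_step_moment j :
  (\int[P]_w (V 0%N w ^+ j)%:E = (expR 1 ^+ j * (1 + 2 * j%:R) `^ (- (3 / 2)))%:E)%E.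
Proof.
have j0 : 0 <= j%:R :> R by [].
have m : measurable_fun setT (fun x : R => (expR (- j%:R * x))%:E).
  by apply/measurable_EFinP/measurableT_comp => //; exact: measurable_funM.
have e0 x : (0 <= (expR (- j%:R * x) : R)%:E)%E by rewrite lee_fin expR_ge0.
have := gamma_laplace lawA (ltr0n R 2) j0.
rewrite (ge0_integral_law (A 0%N) m e0) => L.
rewrite EFinM -L -ge0_integralZl_EFin ?exprn_ge0 ?expR_ge0//; last first.
  by apply: (measurableT_comp m); exact: measurable_funP.
apply: eq_integral => w _ /=; rewrite -EFinM /rv_comp; congr EFin.
rewrite -!expRM_natl -expRD; congr expR; ring.
Qed.

(** The variable [A 0] is positive only almost surely, so the truncation at [expR 1] is compared
    under the integral, where the gamma density vanishes off the positive half-line. *)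
Lemma gamma_step_min_moment :
  (\int[P]_w (Num.min (V 0%N w) (expR 1))%:E = \int[P]_w (V 0%N w)%:E)%E.
Proof.
have mf : measurable_fun setT (fun x : R => (Num.min (expR (1 - x)) (expR 1))%:E).
  by apply/measurable_EFinP; exact: measurable_minr.
have mg : measurable_fun setT (fun x : R => (expR (1 - x))%:E).
  exact/measurable_EFinP.
have f0 x : (0 <= (Num.min (expR (1 - x)) (expR 1) : R)%:E)%E.
  by rewrite lee_fin le_min !expR_ge0.
have g0 x : (0 <= (expR (1 - x) : R)%:E)%E by rewrite lee_fin expR_ge0.
have := eq_integral_gamma lawA mf mg f0 g0.
rewrite (ge0_integral_law (A 0%N) mf f0) (ge0_integral_law (A 0%N) mg g0); apply.
by move=> x x0; rewrite min_l// ler_expR gerBl ltW.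
Qed.

Lemma bs_N_gamma_step (x eps T : R) z w : 0 < eps ->
  bs_N (fun _ : R => 1) x eps (fun n => A n w) z T =
  hitting_index (fun n => psum V n w) (T / eps ^+ 2).
Proof.
move=> e0.
have sE n : bs_s (fun _ : R => 1) x eps (fun n => A n w) z n = eps ^+ 2 * psum V n w.
  elim: n => [|n IH]; first by rewrite /bs_s big_ord0 psum0 mulr0.
  rewrite psumS mulrDr -IH /bs_s big_ord_recr/=; congr (_ + _).
  by rewrite /bs_U /bs_duration expr1n mulr1.
rewrite /bs_N /hitting_index; congr (ereal_inf [set _ | _ in _]).
apply/seteqP; split => n /= [n1 Tn]; split => //; move: Tn;
  by rewrite sE ler_pdivrMr ?exprn_gt0// mulrC.
Qed.

End gamma_skeleton.

Theorem proposition2p3 (R : realType) (d : measure_display)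
    (Omega : measurableType d) (P : probability Omega R)
    (A Z : nat -> {RV P >-> R}) (T x : R) :
  iid_gamma (3 / 2) 2 A ->
  iid_rademacher Z ->
  independent_seqs A Z ->
  0 < T ->
  let N := fun (eps : R) (w : Omega) =>
    bs_N (fun _ : R => 1) x eps (fun n => A n w) (fun n => Z n w) T in
  let mu : R := expR 1 * 3 `^ (- (3 / 2)) in
  let sigma2 : R := (5 `^ (- (3 / 2)) - 3 `^ (- 3)) * expR 1 ^+ 2 in
  ((eps ^+ 2)%:E * \int[P]_w N eps w)%E @[eps --> (0 : R)^'+]
    --> (T / expR 1 * 3 `^ (3 / 2))%:E
  /\
  cvg_in_distribution P ((0 : R)^'+)
    (fun (eps : R) (w : Omega) =>
      ((Num.sqrt (mu ^+ 3 / (eps ^+ 2 * sigma2 * T)))%:E *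
       ((eps ^+ 2)%:E * N eps w - (T / expR 1 * 3 `^ (3 / 2))%:E))%E)
    (normal_prob (0 : R) 1).
Proof.
move=> iidA _ _ T0 N mu sigma2.
have mu0 : 0 < mu by rewrite mulr_gt0 ?expR_gt0 ?powR_gt0.
have sqrE (a : R) : 0 < a -> (a `^ (- (3 / 2))) ^+ 2 = a `^ (- 3).
  by move=> a0; rewrite -powR_mulrn ?powR_ge0// -powRrM; congr (_ `^ _); field.
have cubeE (a : R) : 0 < a -> a `^ (- 3) = (a ^+ 3)^-1.
  by move=> a0; rewrite powRN powR_mulrn// ltW.
have s0 : 0 < sigma2.
  rewrite mulr_gt0 ?exprn_gt0 ?expR_gt0// subr_gt0.
  (* Squaring removes the half-integer exponent: it remains to compare 3^-6 = 1 / 729 with 5^-3 = 1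
     / 125. *)
  rewrite -(ltr_pXn2r (n := 2)) ?nnegrE ?powR_ge0// sqrE// !cubeE//; lra.
have T_mu : T / expR 1 * 3 `^ (3 / 2) = T / mu.
  by rewrite /mu powRN; field; rewrite !gt_eqF ?expR_gt0 ?powR_gt0.
pose sd := Num.sqrt sigma2; have sd0 : 0 < sd by rewrite sqrtr_gt0.
have EV : (\int[P]_w (gamma_step A 0%N w)%:E = mu%:E)%E.
  rewrite (gamma_step_moment iidA 1) mulr1 expr1; congr (_ * _ `^ _)%:E; ring.
have EV2 : (\int[P]_w (gamma_step A 0%N w ^+ 2)%:E = (mu ^+ 2 + sd ^+ 2)%:E)%E.
  rewrite (gamma_step_moment iidA 2) /sd sqr_sqrtr ?ltW// /mu exprMn sqrE//.
  rewrite (_ : 1 + 2 * 2%:R = 5 :> R); last by ring.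
  by congr EFin; rewrite /sigma2; ring.
have EV3 : (\int[P]_w (gamma_step A 0%N w ^+ 3)%:E < +oo)%E.
  by rewrite (gamma_step_moment iidA 3) ltry.
have indV := independent_gamma_step iidA.
have same := identically_distributed_gamma_step iidA.
have NE eps : 0 < eps ->
    N eps = (fun w => hitting_index (fun n => psum (gamma_step A) n w) (T / eps ^+ 2)).
  by move=> e0; apply/funext => w; exact: bs_N_gamma_step.
have scaleE eps : 0 < eps -> Num.sqrt (mu ^+ 3 / (eps ^+ 2 * sigma2 * T)) =
    (eps * (sd * Num.sqrt (T / mu) / mu))^-1.
  (* The right-hand side, the normalization in [renewal_clt], is nonnegative, hence the square root
     of its square. *)
  move=> e0; rewrite -[RHS]ger0_norm; last first.
    by rewrite invr_ge0 !mulr_ge0 ?sqrtr_ge0// ?invr_ge0 ltW.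
  rewrite -sqrtr_sqr; congr Num.sqrt.
  have st0 : 0 < Num.sqrt (T / mu) by rewrite sqrtr_gt0 divr_gt0.
  have -> : (eps * (sd * Num.sqrt (T / mu) / mu))^-1 ^+ 2 =
      mu ^+ 2 / (eps ^+ 2 * sd ^+ 2 * Num.sqrt (T / mu) ^+ 2).
    by field; rewrite !gt_eqF.
  rewrite !sqr_sqrtr ?divr_ge0 ?ltW//.
  by field; rewrite !gt_eqF.
rewrite T_mu; split.
  have := renewal_expectation indV same (gamma_step_ge0 A) mu0 EV (expR_ge0 1) T0
    (etrans (gamma_step_min_moment iidA) EV).
  apply: cvg_trans; apply: near_eq_cvg; near=> eps.
  by rewrite NE//; near: eps; exact: nbhs_right_gt.
move=> u _.
have := renewal_clt (u := u) indV same (gamma_step_ge0 A) mu0 EV sd0 EV2 EV3 T0.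
apply: cvg_trans; apply: near_eq_cvg; near=> eps.
have e0 : 0 < eps by near: eps; exact: nbhs_right_gt.
by rewrite NE// scaleE.
Unshelve. all: by end_near. Qed.
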